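(* Let $(M,g)$ be a simply connected pseudo-Riemannian spin manifold of neutral signature $(n,n)$ admitting two complementary parallel isotropic distributions. Then the complex spinor bundle $S$ of $(M,g)$ admits a parallel 1-dimensional complex subbundle.
   Context: A distribution on $M$ is parallel if it is preserved by the Levi-Civita connection $\nabla$, and isotropic if $g$ vanishes on it identically; two distributions $W,W_1\subset TM$ are complementary if $TM=W\oplus W_1$ (so both have rank $n$). $S$ is the complex spinor bundle with fiber the complex spinor module $\Delta_{n,n}=\mathbb{C}^{2^{n}}$, equipped with the connection $\nabla^S$ induced by $\nabla$. A complex subbundle $l\subset S$ is parallel if $\nabla^S_X\sigma\in\Gamma(l)$ for all vector fields $X$ and all local sections $\sigma$ of $l$. *)

(* Defs.v *)
(* MathComp-Analysis, over an arbitrary realType; complex numbers are R[i]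
   (real-closed). *)
From HB Require Import structures.
From mathcomp Require Import all_boot all_order all_algebra.
From mathcomp Require Import all_classical all_reals all_analysis.
From mathcomp Require Import complex.

Set Implicit Arguments.
Unset Strict Implicit.
Unset Printing Implicit Defensive.

Import Order.TTheory GRing.Theory Num.Theory numFieldNormedType.Exports.

Local Open Scope classical_set_scope.
Local Open Scope ring_scope.
Local Open Scope complex_scope.

Definition frame_of (K : nzRingType) (V : lmodType K) (k : nat)
    (e : 'I_k -> V) (W : set V) : Prop :=
  W = [set v | exists a : 'I_k -> K, v = \sum_i a i *: e i] /\
  (forall a : 'I_k -> K, \sum_i a i *: e i = 0 -> forall i, a i = 0).

(** * Smooth manifolds *)

Definition iter_partial (R : realType) (m : nat) (s : seq 'I_m)
    (f : 'rV[R]_m -> R) : 'rV[R]_m -> R :=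
  foldr (fun i h z => 'D_(delta_mx 0 i) h z) f s.

(* On an open V this is C^oo: every iterated partial derivative exists and is
   (Frechet) differentiable, hence continuous. *)
Definition smooth_on (R : realType) (m : nat) (V : set 'rV[R]_m)
    (f : 'rV[R]_m -> R) : Prop :=
  forall s z, V z -> differentiable (iter_partial s f) z.

(* cmap c is only meaningful on cdom c, and cinv c on its image. *)
Record manifold (R : realType) (m : nat) := Manifold {
  mpoint :> topologicalType;
  chart : Type;
  cdom : chart -> set mpoint;
  cmap : chart -> mpoint -> 'rV[R]_m;
  cinv : chart -> 'rV[R]_m -> mpoint;
  chart_at : mpoint -> chart;
  mfd_hausdorff : hausdorff_space mpoint;
  mfd_second_countable : @second_countable mpoint;
  chart_atP : forall x, cdom (chart_at x) x;
  cdom_open : forall c, open (cdom c);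
  cmap_open : forall c, open (cmap c @` cdom c);
  cmapK : forall c x, cdom c x -> cinv c (cmap c x) = x;
  cmap_continuous : forall c, {within cdom c, continuous (cmap c)};
  cinv_continuous : forall c,
    {within cmap c @` cdom c, continuous (cinv c)};
  chart_compat : forall c d i,
    smooth_on (cmap c @` (cdom c `&` cdom d))
              (fun z => cmap d (cinv c z) 0 i) }.

Definition simply_connected (R : realType) (T : topologicalType) : Prop :=
  (forall x y : T, exists p : R -> T,
     [/\ {within `[0, 1], continuous p}, p 0 = x & p 1 = y]) /\
  (forall p : R -> T, {within `[0, 1], continuous p} -> p 0 = p 1 ->
     exists H : R * R -> T,
       [/\ {within `[0, 1] `*` `[0, 1], continuous H},
           (forall t, 0 <= t <= 1 -> H (0, t) = p t),
           (forall t, 0 <= t <= 1 -> H (1, t) = p 0) &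
           (forall s, 0 <= s <= 1 -> H (s, 0) = p 0 /\ H (s, 1) = p 0)]).

Section Tangent.
Context {R : realType} {m : nat} {M : manifold R m}.

Definition smooth (U : set M) (f : M -> R) : Prop :=
  forall c : chart M, smooth_on (cmap c @` (U `&` cdom c)) (f \o cinv c).

(* A tangent vector at x is the family of its coordinate vectors in all the
   charts around x, related by the Jacobians of the chart changes; the value 0
   at the other charts makes this a faithful model of T_x M. *)
Definition tvec : Type := chart M -> 'rV[R]_m.
HB.instance Definition _ := GRing.Lmodule.on tvec.

Definition tangent (x : M) : set tvec := [set v : tvec |
  (forall c, ~ cdom c x -> v c = 0) /\
  (forall c d i, cdom c x -> cdom d x ->
     v d 0 i = 'D_(v c) (fun z => cmap d (cinv c z) 0 i) (cmap c x))].

Definition vfield (U : set M) (X : M -> tvec) : Prop :=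
  (forall x, U x -> tangent x (X x)) /\
  (forall c i, smooth (U `&` cdom c) (fun x => X x c 0 i)).

(* The derivative X f; for f smooth at x it may be computed in any chart. *)
Definition deriv_along (X : M -> tvec) (f : M -> R) (x : M) : R :=
  'D_(X x (chart_at x)) (f \o cinv (chart_at x)) (cmap (chart_at x) x).

(* Rank-k distributions, i.e. rank-k smooth subbundles of TM. *)
Definition tangent_distribution (k : nat) (W : M -> set tvec) : Prop :=
  forall x, exists V : set M, [/\ open V, V x &
    exists w : 'I_k -> M -> tvec, (forall i, vfield V (w i)) /\
      (forall y, V y -> frame_of (fun i => w i y) (W y))].

Definition complementary (W W1 : M -> set tvec) : Prop := forall x,
  (forall v, tangent x v ->
     exists w w1, [/\ W x w, W1 x w1 & v = w + w1]) /\
  (forall v, W x v -> W1 x v -> v = 0).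

(* An affine connection, as an operator on vector fields over open sets:
   fields are total functions, and nabla is local, so that the restriction of
   nabla X Y to U depends only on the restrictions of X and Y. *)
Record connection (nabla : (M -> tvec) -> (M -> tvec) -> M -> tvec) : Prop := {
  nabla_vfield : forall U X Y, open U -> vfield U X -> vfield U Y ->
    vfield U (nabla X Y);
  nabla_local : forall U X X' Y Y', open U ->
    vfield U X -> vfield U X' -> vfield U Y -> vfield U Y' ->
    {in U, X =1 X'} -> {in U, Y =1 Y'} -> {in U, nabla X Y =1 nabla X' Y'};
  nablaDl : forall U X X' Y, open U ->
    vfield U X -> vfield U X' -> vfield U Y ->
    {in U, nabla (fun x => X x + X' x) Y
           =1 (fun x => nabla X Y x + nabla X' Y x)};
  nablaZl : forall U f X Y, open U ->
    smooth U f -> vfield U X -> vfield U Y ->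
    {in U, nabla (fun x => f x *: X x) Y =1 (fun x => f x *: nabla X Y x)};
  nablaDr : forall U X Y Y', open U ->
    vfield U X -> vfield U Y -> vfield U Y' ->
    {in U, nabla X (fun x => Y x + Y' x)
           =1 (fun x => nabla X Y x + nabla X Y' x)};
  nablaZr : forall U f X Y, open U ->
    smooth U f -> vfield U X -> vfield U Y ->
    {in U, nabla X (fun x => f x *: Y x)
           =1 (fun x => deriv_along X f x *: Y x + f x *: nabla X Y x)} }.

Definition parallel_distribution
    (nabla : (M -> tvec) -> (M -> tvec) -> M -> tvec)
    (W : M -> set tvec) : Prop :=
  forall U X Y, open U -> vfield U X -> vfield U Y ->
    (forall x, U x -> W x (Y x)) -> forall x, U x -> W x (nabla X Y x).

Definition isotropic (g : M -> tvec -> tvec -> R) (W : M -> set tvec) : Prop :=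
  forall x v w, W x v -> W x w -> g x v w = 0.

End Tangent.
Arguments tvec {R m} M.

(** * Neutral metrics and the Levi-Civita connection *)

Definition eps (R : realType) (n : nat) (a : 'I_(n + n)) : R :=
  if (a < n)%N then -1 else 1.
Arguments eps R {n} a.

Section Metric.
Context {R : realType} {n : nat} {M : manifold R (n + n)}.

Definition orthonormal_frame (h : tvec M -> tvec M -> R)
    (e : 'I_(n + n) -> tvec M) : Prop :=
  forall a b, h (e a) (e b) = eps R a *+ (a == b).

Record neutral_metric (g : M -> tvec M -> tvec M -> R) : Prop := {
  metric_linear : forall x t u v w, tangent x u -> tangent x v ->
    tangent x w -> g x (t *: u + v) w = t * g x u w + g x v w;
  metric_sym : forall x v w, tangent x v -> tangent x w -> g x v w = g x w v;
  metric_smooth : forall U X Y, open U -> vfield U X -> vfield U Y ->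
    smooth U (fun x => g x (X x) (Y x));
  metric_signature : forall x, exists e : 'I_(n + n) -> tvec M,
    frame_of e (tangent x) /\ orthonormal_frame (g x) e }.

(* In levi_civita_torsion_free the right-hand side is [X, Y] f. *)
Record levi_civita (g : M -> tvec M -> tvec M -> R)
    (nabla : (M -> tvec M) -> (M -> tvec M) -> M -> tvec M) : Prop := {
  levi_civita_connection : connection nabla;
  levi_civita_metric : forall U X Y Z, open U ->
    vfield U X -> vfield U Y -> vfield U Z ->
    {in U, deriv_along X (fun y => g y (Y y) (Z y))
           =1 (fun x => g x (nabla X Y x) (Z x) + g x (Y x) (nabla X Z x))};
  levi_civita_torsion_free : forall U X Y f, open U ->
    vfield U X -> vfield U Y -> smooth U f ->
    {in U, (fun x => deriv_along (nabla X Y) f x - deriv_along (nabla Y X) f x)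
           =1 (fun x => deriv_along X (deriv_along Y f) x
                        - deriv_along Y (deriv_along X f) x)} }.

End Metric.

(** * Spin group and spinor module *)

Section Clifford.
Context {R : realType} {n : nat}.
Implicit Type gamma : 'I_(n + n) -> 'M[R[i]]_(2 ^ n).

(* Clifford multiplication by the standard basis of R^{n,n} on
   Delta_{n,n} = C^(2^n), with the convention v . v = - <v, v>.  A complex
   representation of Cl_{n,n} in dimension 2^n is necessarily the irreducible
   one, and it is unique up to isomorphism. *)
Definition spinor_module gamma : Prop := forall a b,
  gamma a *m gamma b + gamma b *m gamma a =
    (((- 2%:R * eps R a) *+ (a == b))%:C)%:M.

Definition cliff gamma (v : 'rV[R]_(n + n)) : 'M[R[i]]_(2 ^ n) :=
  \sum_a (v 0 a)%:C *: gamma a.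

Definition quad (v : 'rV[R]_(n + n)) : R := \sum_a eps R a * v 0 a ^+ 2.

(* Spin(n,n): products of evenly many vectors v with <v, v> = 1 or -1.  They
   are taken in End Delta_{n,n}, in which Cl_{n,n} embeds. *)
Definition spin gamma : set 'M[R[i]]_(2 ^ n) := [set A |
  exists s : seq 'rV[R]_(n + n),
    [/\ ~~ odd (size s), all (fun v => (quad v == 1) || (quad v == -1)) s &
        A = foldr (fun v B => cliff gamma v *m B) 1%:M s]].

(* L is the matrix of the image of A under Spin(n,n) -> SO(n,n), i.e. of
   v |-> A v A^-1. *)
Definition spin_cover gamma (A : 'M[R[i]]_(2 ^ n)) (L : 'M[R]_(n + n)) : Prop :=
  forall b, A *m gamma b = (\sum_a (L a b)%:C *: gamma a) *m A.

End Clifford.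

(** * Spin structures, spinor bundle and spinor connection *)

Section Spin.
Context {R : realType} {n : nat} {M : manifold R (n + n)}.
Variable g : M -> tvec M -> tvec M -> R.
Variable gamma : 'I_(n + n) -> 'M[R[i]]_(2 ^ n).

Definition csmooth (U : set M) (f : M -> R[i]) : Prop :=
  smooth U (fun x => complex.Re (f x)) /\ smooth U (fun x => complex.Im (f x)).

(* A spin structure, presented by local sections q_i of the Spin(n,n)-bundle
   over a cover sdom: sframe i is the orthonormal frame below q_i, and
   q_j = q_i strans i j. *)
Record spin_structure := SpinStructure {
  sidx : Type;
  sdom : sidx -> set M;
  sframe : sidx -> 'I_(n + n) -> M -> tvec M;
  strans : sidx -> sidx -> M -> 'M[R[i]]_(2 ^ n);
  sdom_open : forall i, open (sdom i);
  sdom_cover : forall x, exists i, sdom i x;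
  sframe_vfield : forall i a, vfield (sdom i) (sframe i a);
  sframe_orthonormal : forall i x, sdom i x ->
    orthonormal_frame (g x) (fun a => sframe i a x);
  strans_spin : forall i j x, sdom i x -> sdom j x ->
    spin gamma (strans i j x);
  strans_smooth : forall i j k l,
    csmooth (sdom i `&` sdom j) (fun x => strans i j x k l);
  strans_cocycle : forall i j k x, sdom i x -> sdom j x -> sdom k x ->
    strans i j x *m strans j k x = strans i k x;
  strans_lift : forall i j x, sdom i x -> sdom j x ->
    exists L, spin_cover gamma (strans i j x) L /\
      (forall b, sframe j b x = \sum_a L a b *: sframe i a x) }.

Variable P : spin_structure.

(* The fiber of S at x: families psi with [q_i, psi i] independent of i, for
   the i with x in sdom i; the value at the other indices is set to 0. *)
Definition svec : Type := sidx P -> 'cV[R[i]]_(2 ^ n).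
HB.instance Definition _ := GRing.Lmodule.on svec.

Definition spinor (x : M) : set svec := [set psi : svec |
  (forall i, ~ sdom i x -> psi i = 0) /\
  (forall i j, sdom i x -> sdom j x -> psi i = strans i j x *m psi j)].

Definition spinor_field (V : set M) (sigma : M -> svec) : Prop :=
  (forall x, V x -> spinor x (sigma x)) /\
  (forall i k, csmooth (V `&` sdom i) (fun x => sigma x i k 0)).

Definition cderiv_along (X : M -> tvec M) (h : M -> 'cV[R[i]]_(2 ^ n)) (x : M) :
    'cV[R[i]]_(2 ^ n) :=
  \col_k (deriv_along X (fun y => complex.Re (h y k 0)) x
          +i* deriv_along X (fun y => complex.Im (h y k 0)) x).

(* The connection induced by nabla: in the frame e = sframe i,
   X(sigma) + 1/2 sum_(a < b) eps_a eps_b g(nabla_X e_a, e_b) e_a e_b sigma. *)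
Definition spinor_nabla (nabla : (M -> tvec M) -> (M -> tvec M) -> M -> tvec M)
    (X : M -> tvec M) (sigma : M -> svec) (x : M) : svec := fun i =>
  if `[< sdom i x >] then
    cderiv_along X (fun y => sigma y i) x +
    \sum_(a < n + n) \sum_(b < n + n | (a < b)%N)
      (2%:R^-1 * eps R a * eps R b
         * g x (nabla X (sframe i a) x) (sframe i b x))%:C
        *: (gamma a *m gamma b *m sigma x i)
  else 0.

Definition complex_subbundle (k : nat) (l : M -> set svec) : Prop :=
  forall x, exists V : set M, [/\ open V, V x &
    exists sigma : 'I_k -> M -> svec, (forall i, spinor_field V (sigma i)) /\
      (forall y, V y -> frame_of (fun i => sigma i y) (l y))].

Definition parallel_subbundle
    (nabla : (M -> tvec M) -> (M -> tvec M) -> M -> tvec M)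
    (l : M -> set svec) : Prop :=
  forall V X sigma, open V -> vfield V X -> spinor_field V sigma ->
    (forall x, V x -> l x (sigma x)) ->
    forall x, V x -> l x (spinor_nabla nabla X sigma x).

End Spin.

(* Main.v *)
(* The line l_x consists of the spinors annihilated by Clifford multiplication
   by W_x.  Dual bases of W_x and W1_x act by operators C_i, D_i satisfying the
   canonical anticommutation relations on a space of dimension 2^n, so the
   projection C_1 D_1 ... C_n D_n onto l_x has trace 1, while the product
   C_1 ... C_n, which is smooth in x and maps into l_x, supplies local sections.
   Differentiating w . sigma = 0 gives
   (nabla_X w) . sigma + w . nabla_X sigma = 0, and nabla_X w is again in W, so
   l is parallel.  That the local formula for nabla_X sigma is compatible with a
   change A of spin frame means A^-1 dA + A^-1 omega_i A = omega_j: both sides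
   have the same commutators with the gamma matrices, hence differ by a scalar,
   and both are traceless, since det A takes values in fourth roots of unity. *)
Require Import Defs.
From mathcomp Require Import all_boot all_order all_algebra.
From mathcomp Require Import all_classical all_reals all_analysis.
From mathcomp Require Import complex.
From mathcomp Require Import zify ring.

Set Implicit Arguments.
Unset Strict Implicit.
Unset Printing Implicit Defensive.

Import Order.TTheory GRing.Theory Num.Theory numFieldNormedType.Exports.

Local Open Scope classical_set_scope.
Local Open Scope ring_scope.
Local Open Scope complex_scope.

(** * Canonical anticommutation relations *)

(** The operators [D] come from inverting a Gram matrix and are used at one point at a time. Only
    the [C] have to vary smoothly, which is why local sections are made from products of the [C]
    alone. Such a product, applied to a fixed vector, may vanish away from the point where the
    vector was chosen, so these sections live on small neighbourhoods. The same relations give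
    Schur's lemma: a matrix commuting with every [gamma a] commutes with all [C] and [D], hence
    preserves the line killed by the [C] and is scalar. Irreducibility of the spinor module is thus
    derived from its dimension 2^n, and it is what turns equal commutators into equality up to a
    scalar. *)

(** For a rank factorization E = A B, idempotency and the one-sided inverses of A and B force B A =
    1, an identity matrix whose size is the rank. *)
Lemma mxrank_idempotent_trace (K : fieldType) (N : nat) (E : 'M[K]_N) :
  E *m E = E -> \tr E = (\rank E)%:R.
Proof.
move=> EE; rewrite -{1}(mulmx_base E) mxtrace_mulC.
have [L LK] := row_fullP (col_base_full E).
have [R RK] := row_freeP (row_base_free E).
move: (mulmx_base E) LK RK; move: (col_base E) (row_base E) => A B AB LK RK.
suff -> : B *m A = 1%:M by rewrite mxtrace1.
have : L *m (A *m B *m (A *m B)) *m R = L *m (A *m B) *m R by rewrite AB EE.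
by rewrite !mulmxA LK !mul1mx -!mulmxA RK mulmx1.
Qed.

Lemma rank1_colP (K : fieldType) (N : nat) (E : 'M[K]_N) (u v : 'cV[K]_N) :
  \rank E = 1%N -> E *m u = u -> u != 0 -> exists a, E *m v = a *: u.
Proof.
move=> E1 Eu u0.
have uE : (u^T <= E^T)%MS by rewrite -Eu trmx_mul submxMl.
have ru : \rank u^T = 1%N.
  by rewrite rank_rV -(inj_eq (@trmx_inj _ _ _)) trmx0 trmxK u0.
have Eu' : (E^T <= u^T)%MS.
  by have := mxrank_leqif_sup uE; rewrite ru mxrank_tr E1 => -[_ <-].
have : ((E *m v)^T <= u^T)%MS by rewrite trmx_mul (submx_trans (submxMl _ _)).
case/sub_rVP=> a aE; exists a; apply: trmx_inj.
by rewrite aE linearZ.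
Qed.

Section CanonicalAnticommutation.
Context {K : numFieldType} {N n : nat}.
Variables C D : 'I_n -> 'M[K]_N.
Hypothesis CC : forall i j, C i *m C j + C j *m C i = 0.
Hypothesis DD : forall i j, D i *m D j + D j *m D i = 0.
Hypothesis CD : forall i j, C i *m D j + D j *m C i = (i == j)%:R%:M.

Let CCN i j : C i *m C j = - (C j *m C i).
Proof. by apply/eqP; rewrite -addr_eq0 CC. Qed.
Let DDN i j : D i *m D j = - (D j *m D i).
Proof. by apply/eqP; rewrite -addr_eq0 DD. Qed.
Let CDN i j : i != j -> C i *m D j = - (D j *m C i).
Proof. by move=> ij; apply/eqP; rewrite -addr_eq0 CD (negPf ij) raddf0. Qed.
Let CD1 i : C i *m D i + D i *m C i = 1%:M.
Proof. by rewrite CD eqxx. Qed.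

Lemma sqr0_of_anticomm (A : 'M[K]_N) : A *m A + A *m A = 0 -> A *m A = 0.
Proof.
rewrite -mulr2n -scaler_nat => /eqP.
by rewrite scaler_eq0 pnatr_eq0 => /eqP.
Qed.

Let C0 i : C i *m C i = 0. Proof. exact: sqr0_of_anticomm. Qed.

Let CDC i : C i *m D i *m C i = C i.
Proof.
by rewrite -mulmxA -[D i *m _](addKr (C i *m D i)) CD1 mulmxDr mulmx1 mulmxN
   mulmxA C0 mul0mx oppr0 add0r.
Qed.

Let CDcommC i j : i != j -> C i *m D i *m C j = C j *m (C i *m D i).
Proof.
move=> ij; rewrite !mulmxA (CCN j i) -!mulmxA -[D i *m C j]opprK.
by rewrite -CDN 1?eq_sym // mulmxN mulNmx mulmxA.
Qed.

Let CDcommD i j : i != j -> C i *m D i *m D j = D j *m (C i *m D i).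
Proof.
move=> ij; rewrite -mulmxA DDN mulmxN !mulmxA -mulNmx; congr (_ *m _).
by rewrite CDN // opprK.
Qed.

(** Each [C j *m D j] is the projection onto the kernel of [C j] along the kernel of [D j], and
    those with distinct indices commute. *)
Definition vacuum_proj (s : seq 'I_n) : 'M[K]_N :=
  foldr (fun j B => C j *m D j *m B) 1%:M s.

(** For duplicate-free [s] the image is the joint kernel of the [C j] with [j] in [s], as for
    [vacuum_proj]; no [D] occurs, so smoothness of the [C] is enough for smoothness of the
    product. *)
Definition creation_prod (s : seq 'I_n) : 'M[K]_N :=
  foldr (fun j B => C j *m B) 1%:M s.

Lemma vacuum_proj_commC s j : j \notin s ->
  vacuum_proj s *m C j = C j *m vacuum_proj s.
Proof.
elim: s => [|i s IH] /=; first by rewrite mul1mx mulmx1.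
rewrite inE negb_or eq_sym => /andP[ij js].
by rewrite -mulmxA IH // !mulmxA -[C j *m C i *m D i]mulmxA -CDcommC // !mulmxA.
Qed.

Lemma vacuum_proj_commD s j : j \notin s ->
  vacuum_proj s *m D j = D j *m vacuum_proj s.
Proof.
elim: s => [|i s IH] /=; first by rewrite mul1mx mulmx1.
rewrite inE negb_or eq_sym => /andP[ij js].
by rewrite -mulmxA IH // !mulmxA -[D j *m C i *m D i]mulmxA -CDcommD // !mulmxA.
Qed.

Lemma vacuum_proj_idem s : uniq s ->
  vacuum_proj s *m vacuum_proj s = vacuum_proj s.
Proof.
elim: s => [|i s IH] /=; first by rewrite mul1mx.
case/andP=> si us; rewrite !mulmxA -[_ *m vacuum_proj s *m C i]mulmxA.
rewrite vacuum_proj_commC // !mulmxA CDC -[_ *m vacuum_proj s *m D i]mulmxA.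
by rewrite vacuum_proj_commD // !mulmxA -mulmxA IH.
Qed.

(** Each factor halves the trace. If F is the projection for the remaining indices, it commutes with
    D_i, so C_i D_i F and D_i C_i F have the same trace by cyclicity, and they add up to F. *)
Lemma vacuum_proj_trace s : uniq s ->
  \tr (vacuum_proj s) * 2 ^+ size s = N%:R.
Proof.
elim: s => [|i s IH] /=; first by rewrite mxtrace1 mulr1.
case/andP=> si us; rewrite -IH // exprS mulrA; congr (_ * _).
rewrite mulr_natr mulr2n -[in RHS](mul1mx (vacuum_proj s)) -(CD1 i).
rewrite mulmxDl [in RHS]linearD /=; congr (_ + _).
rewrite -[in RHS]mulmxA [in RHS]mxtrace_mulC -[in RHS]mulmxA.
by rewrite vacuum_proj_commD // mulmxA.
Qed.

Lemma annihilator_vacuum_proj s i : uniq s -> i \in s ->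
  C i *m vacuum_proj s = 0.
Proof.
elim: s => [//|j s IH] /= /andP[js us].
rewrite inE; have [-> _|ij /= si] := eqVneq i j.
  by rewrite !mulmxA C0 !mul0mx.
by rewrite !mulmxA -[C i *m C j *m D j]mulmxA -CDcommC 1?eq_sym // -mulmxA IH //
  mulmx0.
Qed.

Lemma vacuum_projK s p (v : 'M[K]_(N, p)) :
  (forall i, i \in s -> C i *m v = 0) -> vacuum_proj s *m v = v.
Proof.
elim: s => [|j s IH] /= sv; first by rewrite mul1mx.
rewrite -mulmxA IH; last by move=> i si; apply: sv; rewrite inE si orbT.
rewrite -[C j *m D j](addrK (D j *m C j)) CD1 mulmxBl mul1mx -mulmxA.
by rewrite sv ?mem_head // mulmx0 subr0.
Qed.

(** Factors are peeled off one by one. If C_j D_j F Z = 0, then C_j F Z = C_j D_j C_j F Z = C_j D_j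
    F Z C_j = 0, whence F Z = (C_j D_j + D_j C_j) F Z = 0. *)
Lemma vacuum_proj_faithful s (Z : 'M[K]_N) : uniq s ->
  (forall i, Z *m C i = C i *m Z) -> (forall i, Z *m D i = D i *m Z) ->
  vacuum_proj s *m Z = 0 -> Z = 0.
Proof.
move=> us ZC ZD; elim: s us => [_|j s IH /= /andP[js us]] /=.
  by rewrite mul1mx.
move=> E0; apply: IH => //; set F := vacuum_proj s in E0 *.
have FZC : F *m Z *m C j = C j *m (F *m Z).
  by rewrite -mulmxA ZC mulmxA vacuum_proj_commC // mulmxA.
rewrite -[F *m Z]mul1mx -(CD1 j) mulmxDl mulmxA E0 add0r -mulmxA.
rewrite -{1}(CDC j) -[C j *m D j *m C j *m _]mulmxA -FZC.
by rewrite [C j *m D j *m _]mulmxA [C j *m D j *m _]mulmxA E0 mul0mx mulmx0.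
Qed.

Lemma annihilator_creation_prod s i : i \in s -> C i *m creation_prod s = 0.
Proof.
elim: s => [//|j s IH] /=.
rewrite inE; have [-> _|ij /= si] := eqVneq i j.
  by rewrite !mulmxA C0 !mul0mx.
by rewrite mulmxA CCN mulNmx -mulmxA IH // mulmx0 oppr0.
Qed.

(** If C_j u = 0 then u = C_j (D_j u), and D_j u is still killed by the other C_i, so the induction
    continues with D_j u. *)
Lemma creation_prod_onto_kernel s (u : 'cV[K]_N) : uniq s ->
  (forall i, i \in s -> C i *m u = 0) -> exists v, creation_prod s *m v = u.
Proof.
elim: s u => [u _ _|j s IH u /= /andP[js us] su] /=.
  by exists u; rewrite mul1mx.
have [i si|v vE] := IH (D j *m u) us.
  have ij : i != j by apply: contraNneq js => <-.
  by rewrite mulmxA CDN // mulNmx -mulmxA su ?inE ?si ?orbT // mulmx0 oppr0.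
exists v; rewrite -mulmxA vE mulmxA -[C j *m D j](addrK (D j *m C j)) CD1.
by rewrite mulmxBl mul1mx -mulmxA su ?mem_head // mulmx0 subr0.
Qed.

Hypothesis N2n : N = (2 ^ n)%N.

Let E := vacuum_proj (enum 'I_n).

(** The trace is 2^n divided by 2^n; in characteristic 0 the rank of an idempotent can be read off
    its trace. *)
Lemma vacuum_rank1 : \rank E = 1%N.
Proof.
have NE : N%:R = 2 ^+ n :> K by rewrite N2n natrX.
have := vacuum_proj_trace (enum_uniq 'I_n); rewrite size_enum_ord NE.
rewrite mxrank_idempotent_trace ?vacuum_proj_idem ?enum_uniq //.
rewrite -[RHS]mul1r => /mulIf; rewrite expf_neq0 ?pnatr_eq0 // => /(_ isT)/eqP.
by rewrite pnatr_eq1 => /eqP.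
Qed.

Lemma vacuum_exists : exists2 u : 'cV[K]_N, u != 0 & forall i, C i *m u = 0.
Proof.
have /eqP := vacuum_rank1; rewrite -[E]trmxK mxrank_tr.
have [->|/rowV0Pn[v /submxP[w vE] v0] _] := eqVneq E^T 0; first by rewrite mxrank0.
exists v^T; first by rewrite -(inj_eq trmx_inj) trmxK trmx0.
move=> i; rewrite vE trmx_mul trmxK mulmxA annihilator_vacuum_proj ?mul0mx //.
  exact: enum_uniq.
by rewrite mem_enum.
Qed.

Lemma vacuum_unique (u v : 'cV[K]_N) : u != 0 ->
  (forall i, C i *m u = 0) -> (forall i, C i *m v = 0) -> exists a, v = a *: u.
Proof.
move=> u0 Cu Cv.
have [|a] := @rank1_colP _ _ E u v vacuum_rank1 _ u0.
  by rewrite vacuum_projK.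
by rewrite vacuum_projK //; exists a.
Qed.

Lemma creation_prod_neq0 : exists v : 'cV[K]_N,
  creation_prod (enum 'I_n) *m v != 0.
Proof.
have [u u0 Cu] := vacuum_exists.
have [//|v vE] := creation_prod_onto_kernel (enum_uniq 'I_n) (u := u).
by exists v; rewrite vE.
Qed.

(** Schur's lemma. [Z] preserves the line of vectors killed by all [C], so it acts there as a scalar
    [a]; then [Z - a%:M] kills the image of [E], and [vacuum_proj_faithful] makes it vanish. *)
Lemma car_commutant (Z : 'M[K]_N) :
  (forall i, Z *m C i = C i *m Z) -> (forall i, Z *m D i = D i *m Z) ->
  exists a, Z = a%:M.
Proof.
move=> ZC ZD; have [u u0 Cu] := vacuum_exists.
have [|a aE] := vacuum_unique (v := Z *m u) u0 Cu.
  by move=> i; rewrite mulmxA -ZC -mulmxA Cu mulmx0.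
exists a; apply/eqP; rewrite -subr_eq0; apply/eqP.
apply: (vacuum_proj_faithful (enum_uniq 'I_n)).
- by move=> i; rewrite mulmxBl mulmxBr ZC scalar_mxC.
- by move=> i; rewrite mulmxBl mulmxBr ZD scalar_mxC.
rewrite -/E.
have -> : E *m (Z - a%:M) = (Z - a%:M) *m E.
  suff EZ : E *m Z = Z *m E by rewrite mulmxBr mulmxBl EZ scalar_mxC.
  rewrite /E; elim: (enum 'I_n) => [|j s IH] /=; first by rewrite mul1mx mulmx1.
  by rewrite -mulmxA IH !mulmxA ZC -[_ *m Z *m D j]mulmxA ZD mulmxA.
apply/matrixP => p q.
suff : (Z - a%:M) *m col q E = 0.
  by rewrite colE mulmxA -colE => /colP/(_ p); rewrite [LHS]mxE => ->; rewrite !mxE.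
have [b ->] : exists b, col q E = b *: u.
  apply: vacuum_unique => // i; rewrite colE mulmxA -colE annihilator_vacuum_proj.
  - by apply/colP=> r; rewrite !mxE.
  - exact: enum_uniq.
  - by rewrite mem_enum.
by rewrite -scalemxAr mulmxBl aE mul_scalar_mx subrr scaler0.
Qed.

End CanonicalAnticommutation.

(** * Smooth functions *)

Section SmoothOn.
Context {R : realType} {m : nat}.
Implicit Types (V : set 'rV[R]_m) (f g h : 'rV[R]_m -> R).

Lemma near_eq_differentiable f g z :
  {near z, f =1 g} -> differentiable f z -> differentiable g z.
Proof.
move=> fg df; have [dfc /eqaddoP fo] := (diff_locallyP _ _).1 df.
have go : g \o shift z = cst (g z) + 'd f z +o_ 0 id.
  apply/eqaddoP => e e0.
  have fg0 : \forall y \near (0 : 'rV[R]_m), f (y + z) = g (y + z).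
    by move: fg => /nbhs0P; apply: filterS => y; rewrite addrC.
  near=> y.
  have <- : (f \o shift z - (cst (f z) + 'd f z)) y
          = (g \o shift z - (cst (g z) + 'd f z)) y.
    have fgz : f z = g z := nbhs_singleton fg.
    rewrite fctE /= [in RHS]fctE /= fgz.
    by rewrite (near fg0 y).
  near: y; exact: fo.
apply/diff_locallyP; rewrite (diff_unique dfc go); split=> //.
Unshelve. all: by end_near. Qed.


Lemma iter_partial_ext V s f g : open V -> (forall z, V z -> f z = g z) ->
  forall z, V z -> iter_partial s f z = iter_partial s g z.
Proof.
move=> oV fg; elim: s => [//|i s IH] z Vz /=.
apply: near_eq_derive; apply: filterS (open_nbhs_nbhs (conj oV Vz)) => y Vy.
exact: IH.
Qed.

Lemma smooth_on_ext V f g : open V -> (forall z, V z -> f z = g z) ->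
  smooth_on V f -> smooth_on V g.
Proof.
move=> oV fg sf s z Vz; apply: near_eq_differentiable (sf s z Vz).
apply: filterS (open_nbhs_nbhs (conj oV Vz)) => y Vy.
exact: (iter_partial_ext s oV fg).
Qed.

(** Smoothness by coinduction: it suffices to exhibit a class of differentiable functions stable
    under partial derivatives, where the derivative has to agree with a member of the class only on
    the open set [V]. *)
Lemma smooth_on_coind V (P : ('rV[R]_m -> R) -> Prop) f : open V ->
  (forall h, P h -> (forall z, V z -> differentiable h z) /\
     forall i, exists2 h', P h' &
       forall z, V z -> 'D_(delta_mx 0 i) h z = h' z) ->
  P f -> smooth_on V f.
Proof.
(* [iter_partial] applies the last index of [s] first, so inducting from the end exposes the
   innermost derivative, the one the hypothesis on [P] speaks about. *)
move=> oV PP Pf s; elim/last_ind: s f Pf => [|s i IH] f Pf z Vz.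
  exact: (PP _ Pf).1.
have [_ /(_ i)[g Pg fg]] := PP _ Pf.
rewrite /iter_partial foldr_rcons -/(iter_partial s _).
apply: near_eq_differentiable (IH g Pg z Vz).
apply: filterS (open_nbhs_nbhs (conj oV Vz)) => y Vy.
by apply/esym/(iter_partial_ext s oV).
Qed.

Lemma smooth_on_partial V f i : smooth_on V f ->
  smooth_on V (fun z => 'D_(delta_mx 0 i) f z).
Proof.
move=> sf s z Vz; have := sf (rcons s i) z Vz.
by rewrite /iter_partial foldr_rcons.
Qed.

Lemma smooth_on_differentiable V f z : smooth_on V f -> V z -> differentiable f z.
Proof. by move=> /(_ [::]); apply. Qed.

Lemma smooth_on_cst V (a : R) : open V -> smooth_on V (fun=> a).
Proof.
move=> oV; apply: (@smooth_on_coind V (fun h => exists b, h = cst b)) => //; last by exists a.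
move=> _ [b ->]; split=> [z _|i]; first exact: differentiable_cst.
by exists (cst 0); [exists 0 | move=> z _; rewrite derive_cst].
Qed.

(* This class is stable under partial derivatives by the Leibniz rule, so that
   [smooth_on_coind] gives closure under + and * without counting orders. *)
Inductive smooth_ring V : ('rV[R]_m -> R) -> Prop :=
| SmoothRingBase f of smooth_on V f : smooth_ring V f
| SmoothRingD f g of smooth_ring V f & smooth_ring V g : smooth_ring V (f + g)
| SmoothRingM f g of smooth_ring V f & smooth_ring V g : smooth_ring V (f * g).

Lemma smooth_ring_smooth_on V f : open V -> smooth_ring V f -> smooth_on V f.
Proof.
move=> oV; apply: smooth_on_coind => // h; elim=> {h}.
- move=> h sh; split=> [z|i]; first exact: smooth_on_differentiable.
  by eexists; first exact/SmoothRingBase/smooth_on_partial/sh.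
- move=> h1 h2 _ [d1 p1] _ [d2 p2]; split=> [z Vz|i].
    by apply: differentiableD; [exact: d1|exact: d2].
  have [[g1 s1 e1] [g2 s2 e2]] := (p1 i, p2 i).
  exists (g1 + g2); first exact: SmoothRingD.
  move=> z Vz; rewrite deriveD; [|exact/diff_derivable/d1|exact/diff_derivable/d2].
  by rewrite e1 // e2.
- move=> h1 h2 r1 [d1 p1] r2 [d2 p2]; split=> [z Vz|i].
    by apply: differentiableM; [exact: d1|exact: d2].
  have [[g1 s1 e1] [g2 s2 e2]] := (p1 i, p2 i).
  exists (h1 * g2 + h2 * g1); first by apply: SmoothRingD; exact: SmoothRingM.
  move=> z Vz; rewrite deriveM; [|exact/diff_derivable/d1|exact/diff_derivable/d2].
  by rewrite e1 // e2.
Qed.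

Lemma smooth_onD V f g : open V -> smooth_on V f -> smooth_on V g ->
  smooth_on V (f + g).
Proof.
by move=> oV sf sg; apply: smooth_ring_smooth_on => //; apply: SmoothRingD;
  exact: SmoothRingBase.
Qed.

Lemma smooth_onM V f g : open V -> smooth_on V f -> smooth_on V g ->
  smooth_on V (f * g).
Proof.
by move=> oV sf sg; apply: smooth_ring_smooth_on => //; apply: SmoothRingM;
  exact: SmoothRingBase.
Qed.

End SmoothOn.

(** * Smooth functions on the manifold and their derivatives along fields *)

Section SmoothFunctions.
Context {R : realType} {m : nat} {M : manifold R m}.
Implicit Types (U : set M) (f g : M -> R) (X : M -> tvec M) (x : M).

Lemma chart_image_open c U : open U -> open (cmap c @` (U `&` cdom c)).
Proof.
move=> oU; rewrite openE => _ [x [Ux cx] <-].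
have oI := @cmap_open _ _ M c.
have Ix : (cmap c @` cdom c) (cmap c x) by exists x.
have := @cinv_continuous _ _ M c.
rewrite continuous_open_subspace // => /(_ (cmap c x)).
rewrite inE => /(_ Ix) cont.
have : nbhs (cmap c x) (cinv c @^-1` U).
  by apply: cont; rewrite cmapK //; apply: open_nbhs_nbhs.
rewrite /interior; apply: filterS2 (open_nbhs_nbhs (conj oI Ix)) => _ [y cy <-] /=.
by rewrite cmapK // => Uy; exists y.
Qed.

Lemma chart_image_cinv c U z : (cmap c @` (U `&` cdom c)) z -> U (cinv c z).
Proof. by move=> [x [Ux cx] <-]; rewrite cmapK. Qed.

Lemma smooth_ext U f g : open U -> (forall x, U x -> f x = g x) ->
  smooth U f -> smooth U g.
Proof.
move=> oU fg sf c; apply: smooth_on_ext (sf c); first exact: chart_image_open.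
by move=> z /chart_image_cinv Uz /=; rewrite fg.
Qed.

Lemma smoothS U U' f : U `<=` U' -> smooth U' f -> smooth U f.
Proof.
move=> UU' sf c s _ [x [Ux cx] <-]; apply: sf; exists x => //.
by split=> //; exact: UU'.
Qed.

Lemma smooth_cst U (a : R) : open U -> smooth U (fun=> a : R).
Proof. by move=> oU c; apply: smooth_on_cst; exact: chart_image_open. Qed.

Lemma smoothD U f g : open U -> smooth U f -> smooth U g ->
  smooth U (fun x => f x + g x).
Proof.
by move=> oU sf sg c; apply: smooth_onD (sf c) (sg c); exact: chart_image_open.
Qed.

Lemma smoothM U f g : open U -> smooth U f -> smooth U g ->
  smooth U (fun x => f x * g x).
Proof.
by move=> oU sf sg c; apply: smooth_onM (sf c) (sg c); exact: chart_image_open.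
Qed.

Lemma smoothN U f : open U -> smooth U f -> smooth U (fun x => - f x).
Proof.
move=> oU sf; apply: (@smooth_ext U (fun x => -1 * f x)) => //.
  by move=> x _; rewrite mulN1r.
by apply: smoothM => //; exact: smooth_cst.
Qed.

Lemma smooth_chart_at U f x : U x -> smooth U f ->
  differentiable (f \o cinv (chart_at x)) (cmap (chart_at x) x).
Proof.
move=> Ux sf; apply: smooth_on_differentiable (sf (chart_at x)) _.
by exists x => //; split=> //; exact: chart_atP.
Qed.

Lemma smooth_continuous U f x : open U -> U x -> smooth U f ->
  {for x, continuous f}.
Proof.
move=> oU Ux sf; set c := chart_at x.
have cx : cdom c x := chart_atP x.
have oc := @cdom_open _ _ M c.
have fc := differentiable_continuous (smooth_chart_at Ux sf).
have := @cmap_continuous _ _ M c.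
rewrite continuous_open_subspace // => /(_ x).
rewrite inE => /(_ cx) cc.
have fcc := continuous_comp cc fc.
move=> A; rewrite -[f x](_ : (f \o cinv c \o cmap c) x = _); last first.
  by rewrite /= cmapK.
move/fcc; apply: filterS2 (open_nbhs_nbhs (conj oc cx)) => y cy /=.
by rewrite cmapK.
Qed.

Lemma deriv_along_local U X f g x : open U -> U x ->
  (forall y, U y -> f y = g y) -> deriv_along X f x = deriv_along X g x.
Proof.
move=> oU Ux fg; apply: near_eq_derive.
have oI := @chart_image_open (chart_at x) U oU.
have Ix : (cmap (chart_at x) @` (U `&` cdom (chart_at x))) (cmap (chart_at x) x).
  by exists x => //; split=> //; exact: chart_atP.
by apply: filterS (open_nbhs_nbhs (conj oI Ix)) => z /chart_image_cinv/fg.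
Qed.

Lemma deriv_along_cst X (a : R) x : deriv_along X (fun=> a) x = 0.
Proof. exact: derive_cst. Qed.

Lemma deriv_alongD U X f g x : U x -> smooth U f -> smooth U g ->
  deriv_along X (fun y => f y + g y) x = deriv_along X f x + deriv_along X g x.
Proof.
move=> Ux sf sg; apply: deriveD; apply: diff_derivable.
  exact: smooth_chart_at Ux sf.
exact: smooth_chart_at Ux sg.
Qed.

Lemma deriv_alongM U X f g x : U x -> smooth U f -> smooth U g ->
  deriv_along X (fun y => f y * g y) x
  = deriv_along X f x * g x + f x * deriv_along X g x.
Proof.
move=> Ux sf sg; rewrite /deriv_along.
have df := diff_derivable (v := X x (chart_at x)) (smooth_chart_at Ux sf).
have dg := diff_derivable (v := X x (chart_at x)) (smooth_chart_at Ux sg).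
rewrite (deriveM df dg).
rewrite /= cmapK; last exact: chart_atP.
by rewrite addrC [g x *: _]mulrC.
Qed.

Lemma chart_change_differentiable c d i x : cdom c x -> cdom d x ->
  differentiable (fun z => cmap d (@cinv _ _ M c z) 0 i) (cmap c x).
Proof.
move=> cx dx; apply: smooth_on_differentiable (@chart_compat _ _ M c d i) _.
by exists x.
Qed.

Lemma tangent_lin x (a : R) (u v : tvec M) : tangent x u -> tangent x v ->
  tangent x (a *: u + v).
Proof.
move=> [u0 uJ] [v0 vJ].
have E c : (a *: u + v) c = a *: u c + v c by [].
split=> [c cx|c d i cx dx]; rewrite !E; first by rewrite u0 // v0 // scaler0 addr0.
have df := chart_change_differentiable i cx dx.
by rewrite deriveE // linearP -!deriveE // -uJ // -vJ // !mxE.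
Qed.

End SmoothFunctions.

(** * Complex- and matrix-valued functions *)

Lemma ReM (R : realType) (a b : R[i]) :
  complex.Re (a * b) = complex.Re a * complex.Re b - complex.Im a * complex.Im b.
Proof. by case: a b => [a1 a2] [b1 b2]. Qed.

Lemma ImM (R : realType) (a b : R[i]) :
  complex.Im (a * b) = complex.Re a * complex.Im b + complex.Im a * complex.Re b.
Proof. by case: a b => [a1 a2] [b1 b2]. Qed.

Lemma ReD (R : realType) (a b : R[i]) :
  complex.Re (a + b) = complex.Re a + complex.Re b.
Proof. by case: a b => [a1 a2] [b1 b2]. Qed.

Lemma ImD (R : realType) (a b : R[i]) :
  complex.Im (a + b) = complex.Im a + complex.Im b.
Proof. by case: a b => [a1 a2] [b1 b2]. Qed.

Section ComplexFunctions.
Context {R : realType} {n : nat} {M : manifold R (n + n)}.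
Implicit Types (U : set M) (f g : M -> R[i]) (X : M -> tvec M) (x : M).

Definition cder X f x : R[i] :=
  deriv_along X (fun y => complex.Re (f y)) x
  +i* deriv_along X (fun y => complex.Im (f y)) x.

Lemma csmooth_ext U f g : open U -> (forall x, U x -> f x = g x) ->
  csmooth U f -> csmooth U g.
Proof.
by move=> oU fg [f1 f2]; split;
  [apply: smooth_ext f1|apply: smooth_ext f2] => // y Uy; rewrite fg.
Qed.

Lemma csmoothS U U' f : U `<=` U' -> csmooth U' f -> csmooth U f.
Proof. by move=> UU' [f1 f2]; split; [apply: smoothS f1|apply: smoothS f2]. Qed.

Lemma csmooth_cst U (a : R[i]) : open U -> csmooth U (fun=> a).
Proof. by move=> oU; split; exact: smooth_cst. Qed.

Lemma csmooth_real U (f : M -> R) : open U -> smooth U f ->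
  csmooth U (fun x => (f x)%:C).
Proof. by move=> oU sf; split=> //; exact: smooth_cst. Qed.

Lemma csmoothD U f g : open U -> csmooth U f -> csmooth U g ->
  csmooth U (fun x => f x + g x).
Proof.
move=> oU [f1 f2] [g1 g2]; split.
- by under eq_fun do rewrite ReD; exact: smoothD.
- by under eq_fun do rewrite ImD; exact: smoothD.
Qed.

Lemma csmoothM U f g : open U -> csmooth U f -> csmooth U g ->
  csmooth U (fun x => f x * g x).
Proof.
move=> oU [f1 f2] [g1 g2]; split.
- under eq_fun do rewrite ReM; apply: smoothD; rewrite //; first exact: smoothM.
  by apply: smoothN => //; exact: smoothM.
- by under eq_fun do rewrite ImM; apply: smoothD => //; exact: smoothM.
Qed.

Lemma csmooth_sum U (I : Type) (r : seq I) (F : I -> M -> R[i]) : open U ->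
  (forall i, csmooth U (F i)) -> csmooth U (fun x => \sum_(i <- r) F i x).
Proof.
move=> oU sF; elim: r => [|i r IH].
  by under eq_fun do rewrite big_nil; exact: csmooth_cst.
by under eq_fun do rewrite big_cons; exact: csmoothD.
Qed.

Lemma csmooth_prod U (I : Type) (r : seq I) (F : I -> M -> R[i]) : open U ->
  (forall i, csmooth U (F i)) -> csmooth U (fun x => \prod_(i <- r) F i x).
Proof.
move=> oU sF; elim: r => [|i r IH].
  by under eq_fun do rewrite big_nil; exact: csmooth_cst.
by under eq_fun do rewrite big_cons; exact: csmoothM.
Qed.

Lemma cder_local U X f g x : open U -> U x -> (forall y, U y -> f y = g y) ->
  cder X f x = cder X g x.
Proof.
by move=> oU Ux fg; congr (_ +i* _); apply: (deriv_along_local X oU Ux) => y Uy;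
  rewrite fg.
Qed.

Lemma cder_cst X (a : R[i]) x : cder X (fun=> a) x = 0.
Proof. by rewrite /cder !deriv_along_cst. Qed.

Lemma cder_real X (f : M -> R) x :
  cder X (fun y => (f y)%:C) x = (deriv_along X f x)%:C.
Proof. by rewrite /cder /= deriv_along_cst. Qed.

Lemma cderD U X f g x : U x -> csmooth U f -> csmooth U g ->
  cder X (fun y => f y + g y) x = cder X f x + cder X g x.
Proof.
move=> Ux [f1 f2] [g1 g2]; rewrite /cder.
under eq_fun do rewrite ReD; under [X in _ +i* deriv_along _ X _]eq_fun do rewrite ImD.
by rewrite !(deriv_alongD (U := U)).
Qed.

Lemma deriv_alongN U X (f : M -> R) x : open U -> U x -> smooth U f ->
  deriv_along X (fun y => - f y) x = - deriv_along X f x.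
Proof.
move=> oU Ux sf; under eq_fun do rewrite -mulN1r.
rewrite (deriv_alongM (U := U)) //; last exact: smooth_cst.
by rewrite deriv_along_cst mul0r add0r mulN1r.
Qed.

Lemma cderM U X f g x : open U -> U x -> csmooth U f -> csmooth U g ->
  cder X (fun y => f y * g y) x = cder X f x * g x + f x * cder X g x.
Proof.
move=> oU Ux [f1 f2] [g1 g2]; rewrite /cder.
under eq_fun do rewrite ReM; under [X in _ +i* deriv_along _ X _]eq_fun do rewrite ImM.
rewrite (deriv_alongD (U := U)) //; [|exact: smoothM|by apply: smoothN => //; exact: smoothM].
rewrite (deriv_alongN (U := U)) //; last exact: smoothM.
rewrite (deriv_alongD (U := U)) //; [|exact: smoothM|exact: smoothM].
rewrite !(deriv_alongM (U := U)) //.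
case: (f x) (g x) => [a1 a2] [b1 b2] /=.
apply/eqP; rewrite eq_complex /=; apply/andP; split; apply/eqP.
  by rewrite opprD addrACA.
by rewrite addrACA.
Qed.

Lemma cder_sum U X (I : Type) (r : seq I) (F : I -> M -> R[i]) x :
  open U -> U x -> (forall i, csmooth U (F i)) ->
  cder X (fun y => \sum_(i <- r) F i y) x = \sum_(i <- r) cder X (F i) x.
Proof.
move=> oU Ux sF; elim: r => [|i r IH].
  by under eq_fun do rewrite big_nil; rewrite cder_cst big_nil.
under eq_fun do rewrite big_cons; rewrite big_cons -IH.
by apply: (cderD (U := U)) => //; exact: csmooth_sum.
Qed.

(** The Leibniz rule in this form keeps every summand a product over the whole list. For a term of a
    determinant it then reads as the same term of the matrix with one row differentiated. *)
Lemma cder_prod U X (I : eqType) (r : seq I) (F : I -> M -> R[i]) x :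
  open U -> U x -> (forall i, csmooth U (F i)) -> uniq r ->
  cder X (fun y => \prod_(i <- r) F i y) x =
  \sum_(k <- r) \prod_(i <- r) (if i == k then cder X (F i) x else F i x).
Proof.
move=> oU Ux sF; elim: r => [_|j r IH /= /andP[jr ur]].
  by under eq_fun do rewrite big_nil; rewrite cder_cst big_nil.
under eq_fun do rewrite big_cons; rewrite big_cons (cderM _ oU) //; last first.
  exact: csmooth_prod.
rewrite IH // big_cons eqxx; congr (_ * _ + _).
  apply: eq_big_seq => i ir; case: eqP => // ij.
  by rewrite -ij ir in jr.
rewrite big_distrr /=; apply: eq_big_seq => k kr.
rewrite big_cons; case: eqP => // jk.
by rewrite jk kr in jr.
Qed.

Definition msmooth p q U (F : M -> 'M[R[i]]_(p, q)) : Prop :=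
  forall i j, csmooth U (fun x => F x i j).

Definition mder p q X (F : M -> 'M[R[i]]_(p, q)) x : 'M[R[i]]_(p, q) :=
  \matrix_(i, j) cder X (fun y => F y i j) x.

Lemma msmooth_ext p q U (F G : M -> 'M[R[i]]_(p, q)) : open U ->
  (forall x, U x -> F x = G x) -> msmooth U F -> msmooth U G.
Proof.
by move=> oU FG sF i j; apply: csmooth_ext (sF i j) => // x Ux; rewrite FG.
Qed.

Lemma msmoothS p q U U' (F : M -> 'M[R[i]]_(p, q)) : U `<=` U' ->
  msmooth U' F -> msmooth U F.
Proof. by move=> UU' sF i j; apply: csmoothS (sF i j). Qed.

Lemma msmooth_cst p q U (A : 'M[R[i]]_(p, q)) : open U -> msmooth U (fun=> A).
Proof. by move=> oU i j; exact: csmooth_cst. Qed.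

Lemma msmoothZ p q U f (F : M -> 'M[R[i]]_(p, q)) : open U ->
  csmooth U f -> msmooth U F -> msmooth U (fun x => f x *: F x).
Proof.
by move=> oU sF sG i j; under eq_fun do rewrite mxE; exact: csmoothM.
Qed.

Lemma msmooth_sum p q U (I : Type) (r : seq I) (F : I -> M -> 'M[R[i]]_(p, q)) :
  open U -> (forall i, msmooth U (F i)) -> msmooth U (fun x => \sum_(i <- r) F i x).
Proof.
move=> oU sF i j; under eq_fun do rewrite summxE.
by apply: csmooth_sum => // k; exact: sF.
Qed.

Lemma msmoothM p q r U (F : M -> 'M[R[i]]_(p, q)) (G : M -> 'M[R[i]]_(q, r)) :
  open U -> msmooth U F -> msmooth U G -> msmooth U (fun x => F x *m G x).
Proof.
move=> oU sF sG i j; under eq_fun do rewrite mxE.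
by apply: csmooth_sum => // k; exact: csmoothM.
Qed.

Lemma mder_local p q U X (F G : M -> 'M[R[i]]_(p, q)) x : open U -> U x ->
  (forall y, U y -> F y = G y) -> mder X F x = mder X G x.
Proof.
move=> oU Ux FG; apply/matrixP=> i j; rewrite !mxE.
by apply: (cder_local X oU Ux) => y Uy; rewrite FG.
Qed.

Lemma mder_cst p q X (A : 'M[R[i]]_(p, q)) x : mder X (fun=> A) x = 0.
Proof. by apply/matrixP=> i j; rewrite !mxE cder_cst. Qed.

Lemma mderZ p q U X f (F : M -> 'M[R[i]]_(p, q)) x : open U -> U x ->
  csmooth U f -> msmooth U F ->
  mder X (fun y => f y *: F y) x = cder X f x *: F x + f x *: mder X F x.
Proof.
move=> oU Ux sf sF; apply/matrixP=> i j; rewrite !mxE.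
by under eq_fun do rewrite mxE; rewrite (cderM _ oU).
Qed.

Lemma mder_sum p q U X (I : Type) (r : seq I) (F : I -> M -> 'M[R[i]]_(p, q)) x :
  open U -> U x -> (forall i, msmooth U (F i)) ->
  mder X (fun y => \sum_(i <- r) F i y) x = \sum_(i <- r) mder X (F i) x.
Proof.
move=> oU Ux sF; apply/matrixP=> i j; rewrite summxE mxE.
under eq_fun do rewrite summxE; rewrite (cder_sum _ _ oU) //.
  by apply: eq_bigr => k _; rewrite mxE.
by move=> k; exact: sF.
Qed.

Lemma mderM p q r U X (F : M -> 'M[R[i]]_(p, q)) (G : M -> 'M[R[i]]_(q, r)) x :
  open U -> U x -> msmooth U F -> msmooth U G ->
  mder X (fun y => F y *m G y) x = mder X F x *m G x + F x *m mder X G x.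
Proof.
move=> oU Ux sF sG; apply/matrixP=> i j; rewrite !mxE.
under eq_fun do rewrite mxE; rewrite (cder_sum _ _ oU) //; last first.
  by move=> k; exact: csmoothM.
by rewrite -big_split; apply: eq_bigr => k _; rewrite (cderM _ oU) // !mxE.
Qed.

Lemma csmooth_det p U (A : M -> 'M[R[i]]_p) : open U -> msmooth U A ->
  csmooth U (fun y => \det (A y)).
Proof.
move=> oU sA; apply: csmooth_sum => // s.
by apply: csmoothM => //; [exact: csmooth_cst | exact: csmooth_prod].
Qed.

(** Jacobi's formula. [B k] is [A x] with row [k] differentiated; expanding along that row leaves
    cofactors in which only [A x] is seen. *)
Lemma cder_det p U X (A : M -> 'M[R[i]]_p) x : open U -> U x -> msmooth U A ->
  cder X (fun y => \det (A y)) x = \tr (mder X A x *m \adj (A x)).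
Proof.
move=> oU Ux sA.
pose B k := \matrix_(i, j) (if i == k then mder X A x i j else A x i j).
transitivity (\sum_k \det (B k)).
  rewrite (cder_sum _ _ oU) // => [|s]; last first.
    by apply: csmoothM => //; [exact: csmooth_cst | exact: csmooth_prod].
  rewrite exchange_big /=; apply: eq_bigr => s _.
  rewrite (cderM _ oU) //; [|exact: csmooth_cst|exact: csmooth_prod].
  rewrite cder_cst mul0r add0r (cder_prod _ oU) ?index_enum_uniq //.
  rewrite big_distrr; apply: eq_bigr => k _; congr (_ * _).
  by apply: eq_bigr => i _; rewrite !mxE.
apply: eq_bigr => k _; rewrite (expand_det_row _ k) mxE; apply: eq_bigr => j _.
rewrite [B k k j]mxE eqxx mxE; congr (_ * _); rewrite [RHS]mxE /cofactor.
congr (_ * \det _); apply/matrixP => a b; rewrite !mxE.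
by rewrite eq_sym (negPf (neq_lift _ _)).
Qed.

Lemma cderiv_alongE X (h : M -> 'cV[R[i]]_(2 ^ n)) x :
  cderiv_along X h x = mder X h x.
Proof. by apply/matrixP=> i j; rewrite !mxE !ord1. Qed.

End ComplexFunctions.

(** * Neutral forms and Clifford multiplication *)

Section NeutralForm.
Context {R : realType} {n : nat}.
Implicit Types u v : 'rV[R]_(n + n).

Definition neutral_mx : 'M[R]_(n + n) := diag_mx (\row_a eps R a).

Definition bil u v : R := (u *m neutral_mx *m v^T) 0 0.

Lemma eps_sqr (a : 'I_(n + n)) : eps R a * eps R a = 1.
Proof. by rewrite /eps; case: ifP; rewrite ?mulrNN mulr1. Qed.

Lemma neutral_mx_sqr : neutral_mx *m neutral_mx = 1%:M.
Proof.
rewrite mulmx_diag -diag_const_mx; congr diag_mx; apply/rowP=> a.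
by rewrite !mxE eps_sqr.
Qed.

Lemma neutral_mx_unit : neutral_mx \in unitmx.
Proof. by have [] := mulmx1_unit neutral_mx_sqr. Qed.

Lemma bilE u v : bil u v = \sum_a eps R a * u 0 a * v 0 a.
Proof.
rewrite /bil mul_mx_diag mxE; apply: eq_bigr => a _.
by rewrite !mxE [u 0 a * _]mulrC.
Qed.

Lemma mulmx_neutral_bil p q (A : 'M[R]_(p, n + n)) (B : 'M[R]_(q, n + n)) i j :
  (A *m neutral_mx *m B^T) i j = bil (row i A) (row j B).
Proof.
rewrite /bil !mul_mx_diag !mxE; apply: eq_bigr => a _.
by rewrite !mxE.
Qed.

(** The rows span a space contained in its own orthogonal, which has dimension n + n - p because the
    form is nondegenerate. *)
Lemma isotropic_rank p (A : 'M[R]_(p, n + n)) :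
  A *m neutral_mx *m A^T = 0 -> row_free A -> (p <= n)%N.
Proof.
move=> /mulmx0_rank_max; rewrite mxrankMfree ?row_free_unit ?neutral_mx_unit //.
by rewrite mxrank_tr /row_free => rA /eqP pA; rewrite pA in rA; lia.
Qed.

Lemma complementary_isotropic_rank k k1 (W : 'M[R]_(k, n + n))
    (W1 : 'M[R]_(k1, n + n)) :
  W *m neutral_mx *m W^T = 0 -> W1 *m neutral_mx *m W1^T = 0 ->
  row_free W -> row_free W1 -> row_full (col_mx W W1) -> k = n /\ k1 = n.
Proof.
move=> WW WW1 fW fW1 full.
have := isotropic_rank WW fW; have := isotropic_rank WW1 fW1.
have : (n + n <= k + k1)%N by rewrite -(eqP full) rank_leq_row.
by lia.
Qed.

(** The Gram matrix [G] between the two spaces is invertible: a combination of rows of [W]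
    orthogonal to [W1] is also orthogonal to [W], hence to everything, and so is 0. Recombining the
    rows of [W1] by the inverse of [G] gives the dual basis and keeps it isotropic. *)
Lemma complementary_isotropic_dual (W W1 : 'M[R]_(n, n + n)) :
  W *m neutral_mx *m W^T = 0 -> W1 *m neutral_mx *m W1^T = 0 ->
  row_free W -> row_full (col_mx W W1) ->
  exists U : 'M[R]_(n, n + n),
    U *m neutral_mx *m U^T = 0 /\ W *m neutral_mx *m U^T = 1%:M.
Proof.
move=> WW WW1 fW /row_fullP[B BW]; pose G := W *m neutral_mx *m W1^T.
have Gu : G \in unitmx.
  rewrite -row_free_unit; apply: inj_row_free => v vG.
  have : v *m W *m neutral_mx = 0.
    rewrite -[LHS]mulmx1 -trmx1 -BW trmx_mul tr_col_mx mulmxA mul_mx_row.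
    rewrite -!mulmxA (mulmxA W) WW mulmx0 (mulmxA W) -/G vG row_mx0.
    by rewrite mul0mx.
  move=> vW0; have : v *m W = 0.
    by rewrite -[LHS]mulmx1 -neutral_mx_sqr mulmxA vW0 mul0mx.
  by move/eqP; rewrite mulmx_free_eq0 // => /eqP.
exists ((invmx G)^T *m W1); split.
  by rewrite trmx_mul trmxK -!mulmxA (mulmxA W1) (mulmxA _ W1^T) WW1 mul0mx mulmx0.
by rewrite trmx_mul trmxK mulmxA mulmxV.
Qed.

End NeutralForm.

(** * Clifford relations, determinants on the spin group, and its Lie algebra *)

Section CliffordAlgebra.
Context {R : realType} {n : nat}.
Variable gamma : 'I_(n + n) -> 'M[R[i]]_(2 ^ n).
Hypothesis gammaP : spinor_module gamma.
Implicit Types u v : 'rV[R]_(n + n).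

Lemma cliff_lin (a : R) u v :
  cliff gamma (a *: u + v) = a%:C *: cliff gamma u + cliff gamma v.
Proof.
rewrite /cliff scaler_sumr -big_split; apply: eq_bigr => b _ /=.
by rewrite scalerA -scalerDl !mxE rmorphD rmorphM.
Qed.

Lemma cliff0 : cliff gamma 0 = 0.
Proof. by rewrite /cliff big1 // => a _; rewrite mxE scale0r. Qed.

Lemma cliff_sum (I : Type) (r : seq I) (c : I -> R) (v : I -> 'rV[R]_(n + n)) :
  cliff gamma (\sum_(i <- r) c i *: v i)
  = \sum_(i <- r) (c i)%:C *: cliff gamma (v i).
Proof.
elim: r => [|i r IH]; first by rewrite !big_nil cliff0.
by rewrite !big_cons cliff_lin IH.
Qed.

Lemma cliff_anticomm u v :
  cliff gamma u *m cliff gamma v + cliff gamma v *m cliff gamma u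
  = ((- 2%:R * bil u v)%:C)%:M.
Proof.
rewrite /cliff 2!mulmx_suml.
under eq_bigr do rewrite mulmx_sumr.
under [X in _ + X]eq_bigr do rewrite mulmx_sumr.
rewrite [X in _ + X]exchange_big -big_split /=.
transitivity (\sum_a ((- 2%:R * (eps R a * u 0 a * v 0 a))%:C)%:M
   : 'M[R[i]]_(2 ^ n)); last first.
  by rewrite bilE mulr_sumr rmorph_sum raddf_sum.
apply: eq_bigr => a _; rewrite -big_split /= (bigD1 a) //= big1 => [|b ba].
  rewrite -!scalemxAl -!scalemxAr !scalerA [(v 0 a)%:C * _]mulrC -scalerDr gammaP.
  rewrite eqxx mulr1n scale_scalar_mx -!rmorphM addr0 /=.
  by congr (real_complex _ _)%:M; ring.
rewrite -!scalemxAl -!scalemxAr !scalerA [(v 0 b)%:C * _]mulrC -scalerDr gammaP.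
by rewrite eq_sym (negPf ba) mulr0n rmorph0 !raddf0.
Qed.

Lemma quad_bil v : quad v = bil v v.
Proof. by rewrite bilE; apply: eq_bigr => a _; rewrite expr2 mulrA. Qed.

Lemma cliff_sqr v : cliff gamma v *m cliff gamma v = ((- quad v)%:C)%:M.
Proof.
have := cliff_anticomm v v; rewrite -quad_bil -mulr2n -scaler_nat.
move/(congr1 (fun A => 2%:R^-1 *: A)); rewrite scalerA mulVf ?pnatr_eq0 // scale1r.
move=> ->; rewrite scale_scalar_mx; congr _%:M.
have -> : (2^-1 : R[i]) = (2^-1 : R)%:C by rewrite fmorphV rmorph_nat.
by rewrite -rmorphM mulrA mulrN mulVf ?pnatr_eq0 // mulN1r.
Qed.

(** A vector with [quad v] equal to 1 or -1 acts with square -1 or 1, so the square of its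
    determinant is a power of a sign. Squaring once more gives 1 whatever the parity of the exponent
    2^n. *)
Lemma spin_det (A : 'M[R[i]]_(2 ^ n)) : spin gamma A -> \det A ^+ 4 = 1.
Proof.
move=> [s [_ /allP sq ->]]; elim: s sq => [|v s IH] /= sq.
  by rewrite det1 expr1n.
rewrite det_mulmx exprMn IH ?mulr1; last by move=> u us; rewrite sq ?inE ?us ?orbT.
have sq2 : \det (cliff gamma v) ^+ 2 = (- quad v)%:C ^+ (2 ^ n).
  by rewrite expr2 -det_mulmx cliff_sqr det_scalar.
rewrite (exprM _ 2 2) sq2 -exprM.
rewrite mulnC exprM -rmorphXn /=.
have -> : (- quad v) ^+ 2 = 1.
  by case/orP: (sq v (mem_head _ _)) => /eqP ->; rewrite ?opprK ?expr1n // sqrrN expr1n.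
by rewrite expr1n.
Qed.

Lemma spin_unit (A : 'M[R[i]]_(2 ^ n)) : spin gamma A -> A \in unitmx.
Proof.
move/spin_det => A4; rewrite unitmxE unitfE; apply/eqP => A0.
by move/eqP: A4; rewrite A0 expr0n /= eq_sym oner_eq0.
Qed.

Lemma gamma_anticomm a b : a != b -> gamma a *m gamma b = - (gamma b *m gamma a).
Proof.
move=> ab; apply/eqP; rewrite -addr_eq0 gammaP (negPf ab) mulr0n.
by rewrite rmorph0.
Qed.

Lemma gamma_commutator a b c : a != b ->
  gamma a *m gamma b *m gamma c - gamma c *m (gamma a *m gamma b) =
  (2%:R * eps R a *+ (a == c))%:C *: gamma b
  - (2%:R * eps R b *+ (b == c))%:C *: gamma a.
Proof.
move=> ab.
have E d e : gamma d *m gamma e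
    = (((- 2%:R * eps R d) *+ (d == e))%:C)%:M - gamma e *m gamma d.
  by rewrite -gammaP addrK.
rewrite -mulmxA (E b c) mulmxBr mul_mx_scalar [gamma a *m (gamma c *m _)]mulmxA.
rewrite (E a c) mulmxBl mul_scalar_mx -mulmxA.
rewrite [- (_ - gamma c *m _)]opprD opprK addrA addrK addrC.
by rewrite !mulNr !mulNrn !rmorphN !scaleNr opprK.
Qed.

(** The lift to the Lie algebra of Spin(n,n) of an infinitesimal rotation with lowered indices.
    Applied to the connection form, it is the zeroth-order term of [spinor_nabla]. *)
Definition spin_form (G : 'I_(n + n) -> 'I_(n + n) -> R) : 'M[R[i]]_(2 ^ n) :=
  \sum_(a < n + n) \sum_(b < n + n | (a < b)%N)
    (2%:R^-1 * eps R a * eps R b * G a b)%:C *: (gamma a *m gamma b).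

(** Distinct gamma matrices anticommute while the trace is cyclic, so each product
    [gamma a *m gamma b] has trace equal to its own negative. *)
Lemma spin_form_trace G : \tr (spin_form G) = 0.
Proof.
rewrite raddf_sum big1 // => a _; rewrite raddf_sum big1 // => b ab /=.
have ab' : a != b by apply: contraTneq ab => ->; rewrite ltnn.
have : \tr (gamma a *m gamma b) = - \tr (gamma a *m gamma b).
  by rewrite {1}mxtrace_mulC (@gamma_anticomm b a) 1?eq_sym //; exact: raddfN.
move/eqP; rewrite -addr_eq0 -mulr2n mulrn_eq0 /= => /eqP t0.
by rewrite mxtraceZ t0 mulr0.
Qed.

(** For the connection form the right-hand side is Clifford multiplication by the covariant
    derivative of the frame vector [c]; this is what dictates the factor 1/2 and the signs in
    [spin_form]. Only pairs containing [c] contribute, and antisymmetry joins those with [c] first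
    and those with [c] second into one full sum. *)
Lemma spin_form_commutator G c : (forall a b, G a b = - G b a) ->
  spin_form G *m gamma c - gamma c *m spin_form G
  = \sum_b (eps R b * G c b)%:C *: gamma b.
Proof.
move=> Ga.
have G0 : G c c = 0.
  by apply/eqP; have /eqP := Ga c c; rewrite -addr_eq0 -mulr2n mulrn_eq0.
rewrite mulmx_suml mulmx_sumr -sumrB.
transitivity (\sum_(a < n + n) \sum_(b < n + n | (a < b)%N)
    ((eps R b * G a b *+ (a == c))%:C *: gamma b
      - (eps R a * G a b *+ (b == c))%:C *: gamma a)).
  apply: eq_bigr => a _; rewrite mulmx_suml mulmx_sumr -sumrB.
  apply: eq_bigr => b ab.
  have ab' : a != b by apply: contraTneq ab => ->; rewrite ltnn.
  rewrite -scalemxAl -scalemxAr -scalerBr gamma_commutator // scalerBr !scalerA.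
  rewrite -!rmorphM; congr (_%:C *: _ - _%:C *: _).
    rewrite !mulrnAr; congr (_ *+ _).
    have -> : 2^-1 * eps R a * eps R b * G a b * (2 * eps R a)
       = 2^-1 * 2 * (eps R a * eps R a) * (eps R b * G a b) by ring.
    by rewrite eps_sqr mulVf ?pnatr_eq0 // !mul1r.
  rewrite !mulrnAr; congr (_ *+ _).
  have -> : 2^-1 * eps R a * eps R b * G a b * (2 * eps R b)
     = 2^-1 * 2 * (eps R b * eps R b) * (eps R a * G a b) by ring.
  by rewrite eps_sqr mulVf ?pnatr_eq0 // !mul1r.
under eq_bigr do rewrite sumrB; rewrite sumrB.
rewrite (bigD1 c) //= [X in _ + X - _]big1 => [|a ac]; last first.
  by rewrite big1 // => b _; rewrite (negPf ac) mulr0n scale0r.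
rewrite addr0 eqxx.
have -> : \sum_(a < n + n) \sum_(b < n + n | (a < b)%N)
     (eps R a * G a b *+ (b == c))%:C *: gamma a =
   \sum_(a < n + n | (a < c)%N) (eps R a * G a c)%:C *: gamma a.
  rewrite [RHS]big_mkcond; apply: eq_bigr => a _; rewrite big_mkcond (bigD1 c) //=.
  rewrite big1 => [|b bc]; last by case: ifP; rewrite // (negPf bc) mulr0n scale0r.
  by rewrite addr0 eqxx.
rewrite -sumrN big_mkcond [X in _ + X]big_mkcond -big_split; apply: eq_bigr => b _ /=.
rewrite mulr1n; case: ltngtP => [cb|bc|/val_inj cb].
- by rewrite addr0.
- by rewrite add0r -scaleNr -rmorphN -mulrN -Ga.
- by rewrite addr0 -cb G0 mulr0 scale0r.
Qed.

End CliffordAlgebra.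

(** * Vector fields and orthonormal frames *)

Lemma frame_of_mem (K : nzRingType) (V : lmodType K) k (e : 'I_k -> V) W i :
  frame_of e W -> W (e i).
Proof.
move=> [-> _]; exists (fun j => (j == i)%:R); rewrite (bigD1 i) //= eqxx scale1r.
by rewrite big1 ?addr0 // => j /negPf ->; rewrite scale0r.
Qed.

Section VectorFields.
Context {R : realType} {m : nat} {M : manifold R m}.
Implicit Types (U : set M) (X Y : M -> tvec M) (x : M).

Lemma tangent0 x : tangent x (0 : tvec M).
Proof.
split=> // c d i cx dx; have -> : (0 : tvec M) c = 0 by [].
by rewrite derive0 mxE.
Qed.

Lemma tangent_sum x (I : Type) (r : seq I) (a : I -> R) (v : I -> tvec M) :
  (forall i, tangent x (v i)) -> tangent x (\sum_(i <- r) a i *: v i).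
Proof.
move=> tv; elim: r => [|i r IH]; first by rewrite big_nil; exact: tangent0.
by rewrite big_cons; exact: tangent_lin.
Qed.

Lemma vfieldS U U' X : U `<=` U' -> vfield U' X -> vfield U X.
Proof.
move=> UU' [tX sX]; split=> [x /UU'/tX //|c i].
by apply: smoothS (sX c i) => x [/UU' Ux cx].
Qed.

Lemma vfield0 U : open U -> vfield U (fun=> 0 : tvec M).
Proof.
move=> oU; split=> [x _|c i]; first exact: tangent0.
have -> : (fun=> (0 : tvec M) c 0 i) = (fun=> 0) :> (M -> R).
  by apply/funext => x; have -> : (0 : tvec M) c = 0 by []; rewrite mxE.
by apply: smooth_cst; apply: openI => //; exact: cdom_open.
Qed.

Lemma vfield_lin U (f : M -> R) X Y : open U -> smooth U f -> vfield U X ->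
  vfield U Y -> vfield U (fun x => f x *: X x + Y x).
Proof.
move=> oU sf [tX sX] [tY sY]; split=> [x Ux|c i].
  by apply: tangent_lin; [exact: tX|exact: tY].
have -> : (fun x => (f x *: X x + Y x) c 0 i)
        = (fun x => f x * X x c 0 i + Y x c 0 i).
  apply/funext => x; have -> : (f x *: X x + Y x) c = f x *: X x c + Y x c by [].
  by rewrite !mxE.
have oc : open (U `&` cdom c) by apply: openI => //; exact: cdom_open.
apply: smoothD => //; apply: smoothM => //.
by apply: smoothS sf => x [].
Qed.

Lemma vfield_scale U (f : M -> R) X : open U -> smooth U f -> vfield U X ->
  vfield U (fun x => f x *: X x).
Proof.
move=> oU sf vX; have := vfield_lin oU sf vX (vfield0 oU).
by under eq_fun do rewrite addr0.
Qed.

Lemma vfield_sum U (I : Type) (r : seq I) (f : I -> M -> R) (X : I -> M -> tvec M) :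
  open U -> (forall i, smooth U (f i)) -> (forall i, vfield U (X i)) ->
  vfield U (fun x => \sum_(i <- r) f i x *: X i x).
Proof.
move=> oU sf vX; elim: r => [|i r IH].
  by under eq_fun do rewrite big_nil; exact: vfield0.
by under eq_fun do rewrite big_cons; exact: vfield_lin.
Qed.

Lemma nabla_sum (nabla : (M -> tvec M) -> (M -> tvec M) -> M -> tvec M)
    U X (I : Type) (r : seq I) (f : I -> M -> R) (Y : I -> M -> tvec M) x :
  connection nabla -> open U -> U x -> vfield U X ->
  (forall i, smooth U (f i)) -> (forall i, vfield U (Y i)) ->
  nabla X (fun y => \sum_(i <- r) f i y *: Y i y) x =
  \sum_(i <- r) (deriv_along X (f i) x *: Y i x + f i x *: nabla X (Y i) x).
Proof.
move=> nc oU Ux vX sf vY; have Ux' : x \in U by rewrite inE.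
elim: r => [|i r IH].
  rewrite big_nil; under eq_fun do rewrite big_nil.
  have -> : (fun=> 0 : tvec M) = (fun _ : M => (0 : R) *: (0 : tvec M)).
    by apply/funext => y; rewrite scaler0.
  rewrite (nablaZr nc oU _ vX (vfield0 oU) Ux'); last exact: smooth_cst.
  by rewrite scale0r scaler0 addr0.
under eq_fun do rewrite big_cons; rewrite big_cons -IH.
rewrite (nablaDr nc oU vX _ _ Ux'); last exact: vfield_sum.
  by rewrite (nablaZr nc oU (sf i) vX (vY i) Ux').
exact: vfield_scale.
Qed.

End VectorFields.

(** * Coordinates in an orthonormal frame of one tangent space *)

Section PointwiseMetric.
Context {R : realType} {n : nat} {M : manifold R (n + n)}.
Variable g : M -> tvec M -> tvec M -> R.
Hypothesis gP : neutral_metric g.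

Definition frame_coord x (e : 'I_(n + n) -> tvec M) (v : tvec M) : 'rV[R]_(n + n) :=
  \row_a (eps R a * g x v (e a)).

Lemma metric_suml x (I : Type) (r : seq I) (a : I -> R) (v : I -> tvec M) w :
  (forall i, tangent x (v i)) -> tangent x w ->
  g x (\sum_(i <- r) a i *: v i) w = \sum_(i <- r) a i * g x (v i) w.
Proof.
move=> tv tw; elim: r => [|i r IH].
  rewrite !big_nil; have := metric_linear gP (-1) tw tw tw.
  by rewrite scaleN1r addNr mulN1r addNr.
by rewrite !big_cons (metric_linear gP) ?IH //; exact: tangent_sum.
Qed.

Variables (x : M) (e : 'I_(n + n) -> tvec M).
Hypothesis te : forall a, tangent x (e a).
Hypothesis oe : orthonormal_frame (g x) e.

Lemma frame_coord_sum (I : Type) (r : seq I) (a : I -> R) (v : I -> tvec M) :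
  (forall i, tangent x (v i)) ->
  frame_coord x e (\sum_(i <- r) a i *: v i) = \sum_(i <- r) a i *: frame_coord x e (v i).
Proof.
move=> tv; apply/rowP => b; rewrite summxE !mxE metric_suml // mulr_sumr.
by apply: eq_bigr => i _; rewrite !mxE mulrCA.
Qed.

Lemma frame_coord_lin (a : R) u v : tangent x u -> tangent x v ->
  frame_coord x e (a *: u + v) = a *: frame_coord x e u + frame_coord x e v.
Proof.
by move=> tu tv; apply/rowP => b; rewrite !mxE (metric_linear gP) // mulrDr mulrCA.
Qed.

Lemma frame_coord_frame a : frame_coord x e (e a) = delta_mx 0 a.
Proof.
apply/rowP => b; rewrite !mxE oe eqxx /= eq_sym; case: eqP => [->|_].
  by rewrite mulr1n eps_sqr.
by rewrite mulr0n mulr0.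
Qed.

(** Orthonormality of [e] has to be turned into spanning. The matrix [B] of [e] in a frame [f] given
    by the signature satisfies B J B^T = J with J invertible, so [B] is invertible and [v] can be
    rewritten in terms of [e]. *)
Lemma tangent_coord v : tangent x v -> v = \sum_a frame_coord x e v 0 a *: e a.
Proof.
move=> tv; have [f [fr of_]] := metric_signature gP x.
have Tf := fr.1; have tf b : tangent x (f b) := frame_of_mem b fr.
have /choice[A eA] a : exists c : 'I_(n + n) -> R, e a = \sum_b c b *: f b.
  by have := te a; rewrite Tf.
pose B : 'M[R]_(n + n) := \matrix_(a, b) A a b.
have BB : B *m neutral_mx *m B^T = neutral_mx.
  apply/matrixP => a b; rewrite mulmx_neutral_bil bilE !mxE -oe.
  rewrite [in RHS]eA metric_suml //; apply: eq_bigr => c _.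
  rewrite (Defs.metric_sym gP) // eA metric_suml // (bigD1 c) //= big1 => [|d dc].
    by rewrite of_ eqxx mulr1n !mxE addr0; ring.
  by rewrite of_ (negPf dc) mulr0n mulr0.
have [Bu _] : B \in unitmx /\ neutral_mx *m B^T *m neutral_mx \in unitmx.
  apply: mulmx1_unit; rewrite !mulmxA BB; exact: neutral_mx_sqr.
have [c vc] : exists c : 'I_(n + n) -> R, v = \sum_b c b *: f b.
  by have := tv; rewrite Tf.
pose d := \row_b c b *m invmx B.
have vd : v = \sum_a d 0 a *: e a.
  rewrite vc; under [RHS]eq_bigr do rewrite eA scaler_sumr.
  rewrite exchange_big; apply: eq_bigr => b _ /=.
  under eq_bigr do rewrite scalerA; rewrite -scaler_suml; congr (_ *: _).
  have : (d *m B) 0 b = c b by rewrite /d mulmxKV // mxE.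
  by rewrite mxE => <-; apply: eq_bigr => a _; rewrite !mxE.
suff -> : frame_coord x e v = d by [].
rewrite vd frame_coord_sum // [RHS]row_sum_delta; apply: eq_bigr => a _.
by rewrite frame_coord_frame.
Qed.

Lemma metric_coord u v : tangent x u -> tangent x v ->
  g x u v = bil (frame_coord x e u) (frame_coord x e v).
Proof.
move=> tu tv; rewrite bilE {1}(tangent_coord tu) metric_suml //.
apply: eq_bigr => a _; rewrite (Defs.metric_sym gP) // [frame_coord x e v 0 a]mxE.
by rewrite -[LHS]mul1r -(eps_sqr a); ring.
Qed.

End PointwiseMetric.

(** * Clifford multiplication and the spin connection in spin frames *)

(* Read with c a gamma matrix, A the change of spin frame, L Clifford
   multiplication by the corresponding vector of the other frame, wi and wj the
   connection forms, and dA, dL derivatives. *)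
Lemma gauge_intertwines (K : pzRingType) N (A dA L dL c wi wj : 'M[K]_N) :
  A *m c = L *m A -> dA *m c = dL *m A + L *m dA ->
  (dL + (wi *m L - L *m wi)) *m A = A *m (wj *m c - c *m wj) ->
  (dA + wi *m A - A *m wj) *m c = L *m (dA + wi *m A - A *m wj).
Proof.
move=> Ac dAc; rewrite mulmxDl mulmxBl mulmxBr => /(canRL (addrK _)) dLA.
rewrite mulmxBl mulmxDl dAc dLA -[wi *m A *m c]mulmxA Ac mulmxBr mulmxDr.
rewrite !mulmxA Ac opprB.
rewrite -[wi *m L *m A]mulmxA.
set a := A *m wj *m c; set b := L *m A *m wj; set d := wi *m (L *m A).
set f := L *m wi *m A; set h := L *m dA.
rewrite [LHS](AC (2*2*1*1*1) ((1*7)*(6*4)*(5*3)*2)) /=.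
by rewrite !subrr !add0r.
Qed.

Section SpinFrames.
Context {R : realType} {n : nat} {M : manifold R (n + n)}.
Variable g : M -> tvec M -> tvec M -> R.
Variable gamma : 'I_(n + n) -> 'M[R[i]]_(2 ^ n).
Variable P : spin_structure g gamma.
Hypothesis gP : neutral_metric g.
Hypothesis gammaP : spinor_module gamma.
Implicit Types (i j : sidx P) (x y : M) (U V : set M) (X Y : M -> tvec M).

Lemma tangent_sframe i x a : sdom i x -> tangent x (sframe i a x).
Proof. by move=> ix; exact: (sframe_vfield i a).1. Qed.

Definition cmul i x (v : tvec M) : 'M[R[i]]_(2 ^ n) :=
  cliff gamma (frame_coord g x (fun a => sframe i a x) v).

Lemma cmul_sum i x (I : Type) (r : seq I) (a : I -> R) (v : I -> tvec M) :
  sdom i x -> (forall k, tangent x (v k)) ->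
  cmul i x (\sum_(k <- r) a k *: v k) = \sum_(k <- r) (a k)%:C *: cmul i x (v k).
Proof.
move=> ix tv; rewrite /cmul (frame_coord_sum gP) ?cliff_sum // => b.
exact: tangent_sframe.
Qed.

Lemma cmul_lin i x (a : R) u v : sdom i x -> tangent x u -> tangent x v ->
  cmul i x (a *: u + v) = a%:C *: cmul i x u + cmul i x v.
Proof.
move=> ix tu tv; rewrite /cmul (frame_coord_lin gP) ?cliff_lin // => b.
exact: tangent_sframe.
Qed.

Lemma cmul_frame i x a : sdom i x -> cmul i x (sframe i a x) = gamma a.
Proof.
move=> ix; rewrite /cmul (frame_coord_frame (sframe_orthonormal ix)) /cliff.
rewrite (bigD1 a) //= mxE !eqxx scale1r big1 ?addr0 // => b ba.
by rewrite mxE (negPf ba) scale0r.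
Qed.

Lemma cmul_anticomm i x u v : sdom i x -> tangent x u -> tangent x v ->
  cmul i x u *m cmul i x v + cmul i x v *m cmul i x u
  = ((- 2%:R * g x u v)%:C)%:M.
Proof.
move=> ix tu tv; rewrite cliff_anticomm // -(metric_coord gP) //.
  by move=> a; exact: tangent_sframe.
exact: sframe_orthonormal.
Qed.

(** Clifford multiplication by a tangent vector is thus well defined on the spinor bundle. On the
    frame vectors of [j] this is the lifting condition of the spin structure; the rest is
    linearity. *)
Lemma cmul_transition i j x v : sdom i x -> sdom j x -> tangent x v ->
  cmul i x v *m strans i j x = strans i j x *m cmul j x v.
Proof.
move=> ix jx tv; have [L [LA eL]] := strans_lift ix jx.
have tj b := tangent_sframe b jx.
rewrite (tangent_coord gP tj (sframe_orthonormal jx) tv).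
rewrite !cmul_sum // mulmx_suml mulmx_sumr; apply: eq_bigr => b _.
rewrite -scalemxAl -scalemxAr cmul_frame // LA eL cmul_sum //; last first.
  by move=> a; exact: tangent_sframe.
by congr (_ *: (_ *m _)); apply: eq_bigr => a _; rewrite cmul_frame.
Qed.

Lemma coord_smooth i U Y a : open U -> U `<=` sdom i -> vfield U Y ->
  smooth U (fun y => frame_coord g y (fun b => sframe i b y) (Y y) 0 a).
Proof.
move=> oU Ui vY; under eq_fun do rewrite mxE.
apply: smoothM => //; first exact: smooth_cst.
by apply: (metric_smooth gP) => //; apply: vfieldS Ui _; exact: sframe_vfield.
Qed.

Lemma cmul_smooth i U Y : open U -> U `<=` sdom i -> vfield U Y ->
  msmooth U (fun y => cmul i y (Y y)).
Proof.
move=> oU Ui vY; apply: msmooth_sum => // a; apply: msmoothZ => //.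
  by apply: csmooth_real => //; exact: coord_smooth.
exact: msmooth_cst.
Qed.

Variable nabla : (M -> tvec M) -> (M -> tvec M) -> M -> tvec M.
Hypothesis nablaP : levi_civita g nabla.
Let nc := levi_civita_connection nablaP.

Definition conn_form X i x a b : R :=
  g x (nabla X (sframe i a) x) (sframe i b x).

Definition spin_conn X i x := spin_form gamma (conn_form X i x).

(** The products of frame vectors are constant, so metric compatibility gives 0 on the left. The
    argument is made on the intersection with [sdom i], where the frame consists of vector
    fields. *)
Lemma conn_form_antisym U X i x a b : open U -> U x -> sdom i x -> vfield U X ->
  conn_form X i x a b = - conn_form X i x b a.
Proof.
move=> oU Ux ix vX; set U' := U `&` sdom i.
have oU' : open U' by apply: openI => //; exact: sdom_open.
have vX' : vfield U' X by apply: vfieldS vX => z [].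
have ve c : vfield U' (sframe i c).
  by apply: vfieldS (sframe_vfield i c) => z [].
have xU' : x \in U' by rewrite inE.
have := levi_civita_metric nablaP oU' vX' (ve a) (ve b) xU'.
rewrite (@deriv_along_local _ _ _ U' X _ (fun=> eps R a *+ (a == b))) //; last first.
  by move=> y [_ iy]; exact: sframe_orthonormal.
rewrite deriv_along_cst => /esym/eqP; rewrite addr_eq0 => /eqP.
rewrite -/(conn_form X i x a b) => ->; congr (- _); apply: (Defs.metric_sym gP).
  exact: tangent_sframe.
exact: (nabla_vfield nc oU' vX' (ve b)).1.
Qed.

(** Clifford multiplication is parallel: in a spin frame, multiplication by the derivative of [Y] is
    the commutator of the spinor derivative with multiplication by [Y]. Differentiating the
    coefficients of [Y] gives the [mder] term, differentiating the frame vectors gives the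
    commutator with [spin_conn]. *)
Lemma cmul_nabla U X Y i x : open U -> U `<=` sdom i -> U x -> vfield U X ->
  vfield U Y ->
  cmul i x (nabla X Y x) = mder X (fun y => cmul i y (Y y)) x
   + (spin_conn X i x *m cmul i x (Y x) - cmul i x (Y x) *m spin_conn X i x).
Proof.
move=> oU Ui Ux vX vY; have ix := Ui _ Ux.
have xU : x \in U by rewrite inE.
pose c a y := frame_coord g y (fun b => sframe i b y) (Y y) 0 a.
have sc a : smooth U (c a) by exact: coord_smooth.
have ve a : vfield U (sframe i a) by apply: vfieldS Ui _; exact: sframe_vfield.
have YE : {in U, Y =1 (fun y => \sum_a c a y *: sframe i a y)}.
  move=> y; rewrite inE => Uy; apply: (tangent_coord gP).
  - by move=> a; exact: tangent_sframe (Ui _ Uy).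
  - exact: sframe_orthonormal (Ui _ Uy).
  - exact: vY.1.
rewrite (nabla_local nc oU vX vX vY (vfield_sum _ oU sc ve) (fun _ _ => erefl) YE xU).
rewrite (nabla_sum _ nc oU Ux vX sc ve) big_split /=.
have tn a : tangent x (nabla X (sframe i a) x).
  exact: (nabla_vfield nc oU vX (ve a)).1.
have te a : tangent x (sframe i a x) by exact: tangent_sframe.
rewrite -[X in cmul i x (X + _)]scale1r cmul_lin //; [|exact: tangent_sum..].
rewrite scale1r !cmul_sum //; congr (_ + _).
  rewrite (mder_sum _ _ oU) //; last first.
    move=> a; apply: msmoothZ => //; last exact: msmooth_cst.
    by apply: csmooth_real => //; exact: sc.
  apply: eq_bigr => a _; rewrite (mderZ _ oU) //; last exact: msmooth_cst.
    2: by apply: csmooth_real => //; exact: sc.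
  by rewrite mder_cst scaler0 addr0 cder_real cmul_frame.
have commE (B : 'M[R[i]]_(2 ^ n)) : B *m cmul i x (Y x) - cmul i x (Y x) *m B
    = \sum_a (c a x)%:C *: (B *m gamma a - gamma a *m B).
  rewrite mulmx_suml mulmx_sumr -sumrB; apply: eq_bigr => a _.
  by rewrite -scalemxAl -scalemxAr -scalerBr.
rewrite commE; apply: eq_bigr => a _; congr (_ *: _).
rewrite spin_form_commutator //; last first.
  by move=> b d; exact: conn_form_antisym vX.
by apply: eq_bigr => b _; rewrite mxE.
Qed.

Lemma spinor_nablaE X (sigma : M -> svec P) i x : sdom i x ->
  spinor_nabla nabla X sigma x i =
  mder X (fun y => sigma y i) x + spin_conn X i x *m sigma x i.
Proof.
move=> ix; rewrite /spinor_nabla asboolT // cderiv_alongE; congr (_ + _).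
rewrite mulmx_suml; apply: eq_bigr => a _; rewrite mulmx_suml.
by apply: eq_bigr => b _; rewrite -scalemxAl.
Qed.

(** The trace is the logarithmic derivative of the determinant, whose fourth power is 1. *)
Lemma trace_log_derivative U X (A : M -> 'M[R[i]]_(2 ^ n)) x :
  open U -> U x -> msmooth U A -> (forall y, U y -> spin gamma (A y)) ->
  \tr (invmx (A x) *m mder X A x) = 0.
Proof.
move=> oU Ux sA spA; have det4 y Uy := spin_det gammaP (spA y Uy).
pose f y := \det (A y); have sf : csmooth U f by exact: csmooth_det.
have f0 : f x != 0 by rewrite -unitfE -unitmxE; exact: spin_unit (spA x Ux).
have sff : csmooth U (fun y => f y * f y) by exact: csmoothM.
(* A nonvanishing function whose square has zero derivative has zero derivative itself; used twice,
   this descends from the fourth power to [f]. *)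
have dsq h : csmooth U h -> h x != 0 -> cder X (fun y => h y * h y) x = 0 ->
    cder X h x = 0.
  move=> sh h0; rewrite (cderM _ oU) // mulrC -mulrDr -mulr2n => /eqP.
  by rewrite mulf_eq0 (negPf h0) mulrn_eq0 /= => /eqP.
have f' : cder X f x = 0.
  apply: (dsq f) => //; apply: (dsq (fun y => f y * f y)) => //.
    by rewrite mulf_neq0.
  rewrite -[RHS](cder_cst X (1 : R[i]) x); apply: (cder_local X oU Ux) => y Uy.
  by rewrite -(det4 y Uy) -/(f y) -!expr2 -exprM.
rewrite /invmx (spin_unit gammaP (spA x Ux)) -scalemxAl mxtraceZ mxtrace_mulC.
by rewrite -(cder_det _ oU) // -/f f' mulr0.
Qed.

(** The gauge law that makes the local formula for the spinor derivative independent of the spin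
    frame. Schur's lemma enters as a hypothesis here and is supplied by [gamma_commutant], which
    rests on the two distributions. *)
Lemma transition_connection V X i j x : open V -> V x -> vfield V X ->
  sdom i x -> sdom j x ->
  (forall Z : 'M[R[i]]_(2 ^ n), (forall a, Z *m gamma a = gamma a *m Z) ->
     exists c, Z = c%:M) ->
  mder X (strans i j) x + spin_conn X i x *m strans i j x
  = strans i j x *m spin_conn X j x.
Proof.
move=> oV Vx vX ix jx comm.
pose U := V `&` (sdom i `&` sdom j).
have oU : open U by do 2?apply: openI => //; exact: sdom_open.
have Ux : U x by [].
have Ui : U `<=` sdom i by move=> y [_ []].
have Uj : U `<=` sdom j by move=> y [_ []].
have vXU : vfield U X by apply: vfieldS vX => y [].
have sA : msmooth U (strans i j).
  by move=> k l; apply: csmoothS (strans_smooth i j k l) => y [].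
have spA y : U y -> spin gamma (strans i j y).
  by move=> [_ [iy jy]]; exact: strans_spin.
set A := strans i j x; set dA := mder X (strans i j) x.
have Au : A \in unitmx by exact: spin_unit (spA x Ux).
set Y := dA + spin_conn X i x *m A - A *m spin_conn X j x.
suff : Y = 0 by move/eqP; rewrite subr_eq0 => /eqP.
pose Lam b y := cmul i y (sframe j b y).
(* The discrepancy [Y] intertwines exactly as the transition matrix [A] does, so [invmx A *m Y]
   commutes with all gamma matrices. *)
have YL b : Y *m gamma b = Lam b x *m Y.
  have vb : vfield U (sframe j b) by apply: vfieldS Uj _; exact: sframe_vfield.
  have sL : msmooth U (Lam b) by exact: cmul_smooth.
  have AL y : U y -> strans i j y *m gamma b = Lam b y *m strans i j y.
    move=> [Vy [iy jy]]; rewrite -(cmul_frame b jy) cmul_transition //.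
    exact: tangent_sframe.
  apply: (@gauge_intertwines _ _ _ _ _ (mder X (Lam b) x)).
  - exact: AL.
  - have := mder_local X oU Ux AL.
    rewrite (mderM _ oU) //; last exact: msmooth_cst.
    by rewrite mder_cst mulmx0 addr0 (mderM _ oU).
  (* Multiplication by the derivative of [sframe j b] is computed in both spin frames. In frame [j]
     the field itself acts by the constant matrix [gamma b], so no derivative term remains there. *)
  - rewrite -(cmul_nabla oU Ui Ux vXU vb) cmul_transition //; last first.
      exact: (nabla_vfield nc oU vXU vb).1.
    rewrite (cmul_nabla oU Uj Ux vXU vb) cmul_frame //.
    rewrite (mder_local X (G := fun=> gamma b) oU Ux) => [|y /Uj jy]; last first.
      exact: cmul_frame.
    by rewrite mder_cst add0r.
have [c cE] : exists c, invmx A *m Y = c%:M.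
  apply: comm => b; rewrite -mulmxA YL.
  have AG : A *m gamma b = Lam b x *m A.
    rewrite /Lam cmul_transition ?cmul_frame //; exact: tangent_sframe.
  have VL : invmx A *m Lam b x = gamma b *m invmx A.
    rewrite -[LHS]mulmx1 -(mulmxV Au) mulmxA -[_ *m Lam b x *m A]mulmxA -AG.
    by rewrite mulKmx.
  by rewrite mulmxA VL mulmxA.
have c0 : c = 0.
  have : \tr (invmx A *m Y) = 0.
    rewrite mulmxBr mulmxDr mulKmx // [invmx A *m (_ *m A)]mulmxA.
    rewrite raddfB raddfD /= (trace_log_derivative _ oU) // add0r.
    by rewrite mxtrace_mulC mulKVmx // !spin_form_trace // subr0.
  rewrite cE mxtrace_scalar => /eqP.
  by rewrite mulrn_eq0 expn_eq0 /= => /eqP.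
by rewrite -[Y](mulKVmx Au) cE c0 raddf0 mulmx0.
Qed.

End SpinFrames.

(** * The pure spinor line *)

Section ComplementaryFrames.
Context {R : realType} {n : nat} {M : manifold R (n + n)}.
Variable g : M -> tvec M -> tvec M -> R.
Variable gamma : 'I_(n + n) -> 'M[R[i]]_(2 ^ n).
Variable P : spin_structure g gamma.
Hypothesis gP : neutral_metric g.
Hypothesis gammaP : spinor_module gamma.
Variables (k k1 : nat) (W W1 : M -> set (tvec M)).
Hypothesis distW : tangent_distribution k W.
Hypothesis distW1 : tangent_distribution k1 W1.
Hypothesis isoW : isotropic g W.
Hypothesis isoW1 : isotropic g W1.
Hypothesis complW : complementary W W1.
Implicit Types (i j : sidx P) (x y : M) (U V : set M) (X Y : M -> tvec M).

Lemma distribution_tangent p (D : M -> set (tvec M)) x v :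
  tangent_distribution p D -> D x v -> tangent x v.
Proof.
move=> /(_ x)[V [oV Vx [w [vw fw]]]]; rewrite (fw x Vx).1 => -[a ->].
by apply: tangent_sum => b; exact: (vw b).1.
Qed.

Let W_tangent x v : W x v -> tangent x v.
Proof. exact: distribution_tangent distW. Qed.
Let W1_tangent x v : W1 x v -> tangent x v.
Proof. exact: distribution_tangent distW1. Qed.

Definition frame_mx i x p (w : 'I_p -> tvec M) : 'M[R]_(p, n + n) :=
  \matrix_a frame_coord g x (fun b => sframe i b x) (w a).

Lemma frame_mx_isotropic i x p (w : 'I_p -> tvec M) : sdom i x ->
  (forall a, tangent x (w a)) -> (forall a b, g x (w a) (w b) = 0) ->
  frame_mx i x w *m neutral_mx *m (frame_mx i x w)^T = 0.
Proof.
move=> ix tw w0; apply/matrixP => a b.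
rewrite mulmx_neutral_bil !rowK -(metric_coord gP) ?w0 ?mxE //.
  by move=> c; exact: tangent_sframe.
exact: sframe_orthonormal.
Qed.

Lemma frame_mx_mul i x p (w : 'I_p -> tvec M) (r : 'rV[R]_p) : sdom i x ->
  (forall a, tangent x (w a)) ->
  r *m frame_mx i x w
  = frame_coord g x (fun b => sframe i b x) (\sum_a r 0 a *: w a).
Proof.
move=> ix tw; rewrite (frame_coord_sum gP) //; last first.
  by move=> c; exact: tangent_sframe.
by rewrite mulmx_sum_row; apply: eq_bigr => a _; rewrite rowK.
Qed.

Lemma frame_mx_free i x p (w : 'I_p -> tvec M) (D : set (tvec M)) : sdom i x ->
  (forall a, tangent x (w a)) -> frame_of w D -> row_free (frame_mx i x w).
Proof.
move=> ix tw [_ indw]; apply: inj_row_free => r; rewrite frame_mx_mul // => r0.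
apply/rowP => a; rewrite mxE; apply: (indw (fun b => r 0 b)).
have tx b := tangent_sframe b ix.
rewrite (tangent_coord gP tx (sframe_orthonormal ix) (tangent_sum _ _ tw)) r0.
by rewrite big1 // => b _; rewrite mxE scale0r.
Qed.

Lemma frame_mx_full i x p p1 (w : 'I_p -> tvec M) (w1 : 'I_p1 -> tvec M) :
  sdom i x -> frame_of w (W x) -> frame_of w1 (W1 x) ->
  row_full (col_mx (frame_mx i x w) (frame_mx i x w1)).
Proof.
move=> ix fw fw1; rewrite -sub1mx; apply/row_subP => a; apply/submxP.
have tx b := tangent_sframe b ix.
have tw b : tangent x (w b) := W_tangent (frame_of_mem b fw).
have tw1 b : tangent x (w1 b) := W1_tangent (frame_of_mem b fw1).
have [/(_ _ (tx a))[u [u1 [Wu W1u E]]] _] := complW x.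
move: Wu W1u; rewrite fw.1 fw1.1 => -[c uE] [c1 u1E].
exists (row_mx (\row_b c b) (\row_b c1 b)); rewrite mul_row_col.
rewrite !frame_mx_mul //.
under eq_bigr do rewrite mxE.
under [X in _ + frame_coord _ _ _ X]eq_bigr do rewrite mxE.
rewrite -uE -u1E rowE mulmx1 -(frame_coord_frame (sframe_orthonormal ix) a) E.
have tu : tangent x u by apply: W_tangent; rewrite fw.1; exists c.
have tu1 : tangent x u1 by apply: W1_tangent; rewrite fw1.1; exists c1.
by rewrite -{1}[u]scale1r (frame_coord_lin gP) // scale1r.
Qed.

Lemma local_frames i x : sdom i x -> exists U, [/\ open U, U x, U `<=` sdom i &
  exists (w : 'I_k -> M -> tvec M) (w1 : 'I_k1 -> M -> tvec M),
    [/\ forall a, vfield U (w a), forall a, vfield U (w1 a),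
      forall y, U y -> frame_of (fun a => w a y) (W y) &
      forall y, U y -> frame_of (fun a => w1 a y) (W1 y)]].
Proof.
move=> ix; have [V [oV Vx [w [vw fw]]]] := distW x.
have [V1 [oV1 Vx1 [w1 [vw1 fw1]]]] := distW1 x.
exists (V `&` V1 `&` sdom i); split.
- by do 2?apply: openI => //; exact: sdom_open.
- by [].
- by move=> y [].
exists w, w1; split.
- by move=> a; apply: vfieldS (vw a) => y [[]].
- by move=> a; apply: vfieldS (vw1 a) => y [[]].
- by move=> y [[Vy _] _]; exact: fw.
- by move=> y [[_ Vy] _]; exact: fw1.
Qed.

(** Isotropy bounds each rank by n, while spanning makes their sum at least n + n. Both facts are
    read off in the tangent space at [x]. *)
Lemma complementary_isotropic_ranks x : k = n /\ k1 = n.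
Proof.
have [i ix] := sdom_cover P x.
have [U [oU Ux Ui [w [w1 [vw vw1 fw fw1]]]]] := local_frames ix.
apply: (@complementary_isotropic_rank _ _ _ _ (frame_mx i x (fun a => w a x))
  (frame_mx i x (fun a => w1 a x))).
- apply: frame_mx_isotropic => // [a|a b]; first exact: (vw a).1.
  exact: isoW (frame_of_mem a (fw x Ux)) (frame_of_mem b (fw x Ux)).
- apply: frame_mx_isotropic => // [a|a b]; first exact: (vw1 a).1.
  exact: isoW1 (frame_of_mem a (fw1 x Ux)) (frame_of_mem b (fw1 x Ux)).
- by apply: frame_mx_free (fw x Ux) => // a; exact: (vw a).1.
- by apply: frame_mx_free (fw1 x Ux) => // a; exact: (vw1 a).1.
- exact: frame_mx_full (fw x Ux) (fw1 x Ux).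
Qed.

End ComplementaryFrames.

(** * The annihilated line as a parallel subbundle *)

Section PureSpinorLine.
Context {R : realType} {n : nat} {M : manifold R (n + n)}.
Variable g : M -> tvec M -> tvec M -> R.
Variable gamma : 'I_(n + n) -> 'M[R[i]]_(2 ^ n).
Variable P : spin_structure g gamma.
Hypothesis gP : neutral_metric g.
Hypothesis gammaP : spinor_module gamma.
Variables (W W1 : M -> set (tvec M)).
Hypothesis distW : tangent_distribution n W.
Hypothesis distW1 : tangent_distribution n W1.
Hypothesis isoW : isotropic g W.
Hypothesis isoW1 : isotropic g W1.
Hypothesis complW : complementary W W1.
Implicit Types (i j : sidx P) (x y : M) (U V : set M) (X Y : M -> tvec M).

Let W_tangent x v : W x v -> tangent x v.
Proof. exact: distribution_tangent distW. Qed.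
Let W1_tangent x v : W1 x v -> tangent x v.
Proof. exact: distribution_tangent distW1. Qed.

Lemma cliff_commute (Z : 'M[R[i]]_(2 ^ n)) v :
  (forall a, Z *m gamma a = gamma a *m Z) ->
  Z *m cliff gamma v = cliff gamma v *m Z.
Proof.
move=> Zg; rewrite mulmx_suml mulmx_sumr; apply: eq_bigr => a _.
by rewrite -scalemxAl -scalemxAr Zg.
Qed.

(** The last clause holds because the [D] are combinations of gamma matrices; it is what lets
    [car_commutant] be applied to the commutant of the [gamma a]. *)
Lemma complementary_car i x (w w1 : 'I_n -> tvec M) : sdom i x ->
  frame_of w (W x) -> frame_of w1 (W1 x) ->
  exists D : 'I_n -> 'M[R[i]]_(2 ^ n),
  [/\ forall a b, cmul i x (w a) *m cmul i x (w b)
        + cmul i x (w b) *m cmul i x (w a) = 0,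
      forall a b, D a *m D b + D b *m D a = 0,
      forall a b, cmul i x (w a) *m D b + D b *m cmul i x (w a)
        = (a == b)%:R%:M &
      forall Z : 'M[R[i]]_(2 ^ n), (forall a, Z *m gamma a = gamma a *m Z) ->
        forall a, Z *m D a = D a *m Z].
Proof.
move=> ix fw fw1.
have tw a : tangent x (w a) := W_tangent (frame_of_mem a fw).
have tw1 a : tangent x (w1 a) := W1_tangent (frame_of_mem a fw1).
have [|||| U [UU WU]] := @complementary_isotropic_dual _ _ (frame_mx i x w)
  (frame_mx i x w1).
- apply: (frame_mx_isotropic gP) => // a b.
  exact: isoW (frame_of_mem a fw) (frame_of_mem b fw).
- apply: (frame_mx_isotropic gP) => // a b.
  exact: isoW1 (frame_of_mem a fw1) (frame_of_mem b fw1).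
- exact: (frame_mx_free gP ix tw fw).
- exact: (frame_mx_full gP distW distW1 complW).
(* This factor cancels the -2 in the Clifford relation, so that dual vectors have anticommutator
   1. *)
pose c : R[i] := (- 2^-1)%:C.
exists (fun a => c *: cliff gamma (row a U)); split => [a b|a b|a b|Z Zg a].
- rewrite (cmul_anticomm gP) // (isoW (frame_of_mem a fw) (frame_of_mem b fw)).
  by rewrite mulr0 rmorph0.
- rewrite -!scalemxAl -!scalemxAr -!scalerDr cliff_anticomm //.
  by rewrite -mulmx_neutral_bil UU mxE mulr0 rmorph0 !scaler0.
- rewrite -!scalemxAl -!scalemxAr -!scalerDr /cmul cliff_anticomm //.
  have -> : frame_coord g x (fun d => sframe i d x) (w a) = row a (frame_mx i x w).
    by rewrite rowK.
  rewrite -mulmx_neutral_bil WU mxE scale_scalar_mx -rmorphM; congr _%:M.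
  have -> : - 2^-1 * (- 2%:R * (a == b)%:R) = (a == b)%:R :> R.
    by rewrite mulrA mulrNN mulVf ?pnatr_eq0 // mul1r.
  by rewrite rmorph_nat.
- by rewrite -scalemxAl -scalemxAr cliff_commute.
Qed.

Lemma gamma_commutant x (Z : 'M[R[i]]_(2 ^ n)) :
  (forall a, Z *m gamma a = gamma a *m Z) -> exists c, Z = c%:M.
Proof.
move=> Zg; have [i ix] := sdom_cover P x.
have [U [oU Ux Ui [w [w1 [vw vw1 fw fw1]]]]] := local_frames distW distW1 ix.
have [D [CC DD CD ZD]] := complementary_car ix (fw x Ux) (fw1 x Ux).
apply: (car_commutant CC DD CD) => // a; last exact: ZD.
exact: cliff_commute.
Qed.

Definition spinor_line x : set (svec P) := [set psi | spinor x psi /\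
  forall i v, sdom i x -> W x v -> cmul i x v *m psi i = 0].

(** Transition matrices intertwine the Clifford multiplications of two spin frames, so annihilation
    in one frame passes to all others. *)
Lemma spinor_line_at i x (psi : svec P) : sdom i x -> spinor x psi ->
  (forall v, W x v -> cmul i x v *m psi i = 0) -> spinor_line x psi.
Proof.
move=> ix sp k0; split=> // j v jx Wv.
rewrite (sp.2 j i) // mulmxA (cmul_transition gP) //; last exact: W_tangent.
by rewrite -mulmxA k0 // mulmx0.
Qed.

Lemma strans_id i x : sdom i x -> strans i i x = 1%:M.
Proof.
move=> ix; have Au := spin_unit gammaP (strans_spin ix ix).
by rewrite -[LHS](mulKmx Au) strans_cocycle // mulVmx.
Qed.

Lemma nonvanishing_nbhs U (s : M -> 'cV[R[i]]_(2 ^ n)) x : open U -> U x ->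
  msmooth U s -> s x != 0 ->
  exists V, [/\ open V, V x, V `<=` U & forall y, V y -> s y != 0].
Proof.
move=> oU Ux ss sx; have [l lx] : exists l, s x l 0 != 0.
  by apply/existsP; apply: contraNT sx => /existsPn sx; apply/eqP/colP => l;
    rewrite mxE; apply/eqP; have := sx l; rewrite negbK.
have [h [sh hx hs]] : exists h : M -> R, [/\ smooth U h, h x != 0 &
    forall y, h y != 0 -> s y != 0].
  have [s1 s2] := ss l 0.
  have [r0|r0] := eqVneq (complex.Re (s x l 0)) 0.
    exists (fun y => complex.Im (s y l 0)); split=> //.
      by apply: contraNneq lx => i0; rewrite eq_complex r0 i0 eqxx.
    by move=> y; apply: contraNneq => ->; rewrite mxE.
  exists (fun y => complex.Re (s y l 0)); split=> //.
  by move=> y; apply: contraNneq => ->; rewrite mxE.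
have ch := smooth_continuous oU Ux sh.
have : nbhs x (U `&` [set y | h y != 0]).
  apply: filterI; first exact: open_nbhs_nbhs.
  exact: (ch [set z | z != 0] (open_nbhs_nbhs (conj (@open_neq _ 0) hx))).
rewrite nbhsE => -[V [oV Vx] VU]; exists V; split=> // y Vy.
  exact: (VU y Vy).1.
by apply: hs; exact: (VU y Vy).2.
Qed.

Lemma spinor_line_subbundle : complex_subbundle 1 spinor_line.
Proof.
move=> x; have [i ix] := sdom_cover P x.
have [U [oU Ux Ui [w [w1 [vw vw1 fw fw1]]]]] := local_frames distW distW1 ix.
pose C y := fun a => cmul i y (w a y).
(* The vector is chosen at [x] and then frozen, so that [s] inherits smoothness from the Clifford
   multiplications; nonvanishing is then only guaranteed near [x]. *)
have [v v0] : exists v : 'cV[R[i]]_(2 ^ n),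
    creation_prod (C x) (enum 'I_n) *m v != 0.
  have [D [CC DD CD _]] := complementary_car ix (fw x Ux) (fw1 x Ux).
  exact: (creation_prod_neq0 CC DD CD).
pose s y := creation_prod (C y) (enum 'I_n) *m v.
have ss : msmooth U s.
  apply: msmoothM => //; last exact: msmooth_cst.
  elim: (enum 'I_n) => [|a r IH] /=; first exact: msmooth_cst.
  by apply: msmoothM => //; exact: (cmul_smooth gP).
have [V [oV Vx VU s0]] := nonvanishing_nbhs oU Ux ss v0.
have Vi y : V y -> sdom i y by move=> /VU/Ui.
(* The section is [s] in frame [i], carried to the other frames by the cocycle, with the default 0
   that [spinor] demands at indices whose domain misses [y]. *)
pose sigma y : svec P := fun j =>
  if `[< sdom j y >] then strans j i y *m s y else 0.
have sigmaE y j : sdom j y -> sigma y j = strans j i y *m s y.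
  by move=> jy; rewrite /sigma asboolT.
have sigma_i y : V y -> sigma y i = s y.
  by move=> Vy; rewrite sigmaE ?strans_id ?mul1mx //; exact: Vi.
have sigma_spinor y : V y -> spinor y (sigma y).
  move=> Vy; split=> [j jy|j l jy ly]; first by rewrite /sigma asboolF.
  by rewrite !sigmaE // mulmxA strans_cocycle //; exact: Vi.
have annihP y (phi : 'cV[R[i]]_(2 ^ n)) : V y ->
    (forall a, C y a *m phi = 0) <-> (forall u, W y u -> cmul i y u *m phi = 0).
  move=> Vy; have fy := fw y (VU y Vy); split=> [Cphi u|Wphi a]; last first.
    by apply: Wphi; exact: (frame_of_mem a fy).
  rewrite fy.1 => -[c ->]; rewrite (cmul_sum gP) //; last 2 first.
  - exact: Vi.
  - by move=> a; apply: W_tangent; exact: (frame_of_mem a fy).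
  by rewrite mulmx_suml big1 // => a _; rewrite -scalemxAl Cphi scaler0.
exists V; split=> //; exists (fun=> sigma); split=> [_|y Vy].
  split=> // j l; have oVj : open (V `&` sdom j) by apply: openI => //; exact: sdom_open.
  have : msmooth (V `&` sdom j) (fun y => strans j i y *m s y).
    apply: msmoothM => //.
      by move=> p q; apply: csmoothS (strans_smooth j i p q) => y [/Vi].
    by apply: msmoothS ss => y [/VU].
  move/msmooth_ext => /(_ (fun y => sigma y j) oVj)/(_ _ l 0); apply.
  by move=> y [_ jy]; rewrite sigmaE.
have iy := Vi y Vy; have Uy := VU y Vy.
have [D [CC DD CD _]] := complementary_car iy (fw y Uy) (fw1 y Uy).
have Cs a : C y a *m s y = 0.
  by rewrite mulmxA annihilator_creation_prod ?mul0mx ?mem_enum.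
split; last first.
  move=> c; rewrite big_ord1 => /(congr1 (fun psi : svec P => psi i)).
  have -> : (c ord0 *: sigma y) i = c ord0 *: sigma y i by [].
  rewrite sigma_i // => /eqP; rewrite scaler_eq0 (negPf (s0 y Vy)) orbF => /eqP c0 a.
  by rewrite ord1.
apply/seteqP; split=> psi.
  move=> [sp psi0].
  have [|c cE] := vacuum_unique CC DD CD erefl (s0 y Vy) Cs (v := psi i).
    by apply: (annihP y _ Vy).2 => u Wu; exact: psi0 iy Wu.
  exists (fun=> c); rewrite big_ord1; apply/funext => j.
  have -> : (c *: sigma y) j = c *: sigma y j by [].
  have [jy|jy] := pselect (sdom j y); last first.
    by rewrite sp.1 // (sigma_spinor y Vy).1 // scaler0.
  by rewrite (sp.2 j i) // cE sigmaE // -scalemxAr.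
move=> [c ->]; rewrite big_ord1; have [sp1 sp2] := sigma_spinor y Vy.
have cE j : (c ord0 *: sigma y) j = c ord0 *: sigma y j by [].
apply: (spinor_line_at iy).
  split=> [j jy|j l jy ly]; rewrite !cE; first by rewrite sp1 // scaler0.
  by rewrite (sp2 j l) // -scalemxAr.
apply: (annihP y _ Vy).1 => a; rewrite cE sigma_i // -scalemxAr.
by rewrite Cs scaler0.
Qed.

Variable nabla : (M -> tvec M) -> (M -> tvec M) -> M -> tvec M.
Hypothesis nablaP : levi_civita g nabla.
Hypothesis parW : parallel_distribution nabla W.

Lemma spinor_line_parallel : parallel_subbundle nabla spinor_line.
Proof.
move=> V X sigma oV vX [sp ssig] lsig x Vx.
have msig i U : U `<=` V `&` sdom i -> msmooth U (fun y => sigma y i).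
  by move=> UV l q; rewrite ord1; apply: csmoothS (ssig i l).
have [i ix] := sdom_cover P x; apply: (spinor_line_at ix).
  (* That the derivative is again a spinor: differentiate the relation between the components in
     frames [j] and [l], then absorb the derivative of the transition matrix by the gauge law. *)
  split=> [j jx|j l jx lx]; first by rewrite /spinor_nabla asboolF.
  rewrite !spinor_nablaE //; pose U := V `&` (sdom j `&` sdom l).
  have oU : open U by do 2?apply: openI => //; exact: sdom_open.
  have Ux : U x by [].
  rewrite (@mder_local _ _ _ _ _ U X _ (fun y => strans j l y *m sigma y l)) //; last first.
    by move=> y [Vy [jy ly]]; exact: (sp y Vy).2.
  rewrite (mderM _ oU) //; last 2 first.
  - by move=> p q; apply: csmoothS (strans_smooth j l p q) => y [].
  - by apply: msig => y [Vy []].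
  rewrite ((sp x Vx).2 j l) // mulmxA addrAC -mulmxDl.
  rewrite (transition_connection gP gammaP nablaP oV Vx vX jx lx (gamma_commutant x)).
  by rewrite -mulmxA -mulmxDr addrC.
move=> u; have [U0 [oU0 Ux0 Ui [w [w1 [vw _ fw _]]]]] := local_frames distW distW1 ix.
pose U := V `&` U0.
have oU : open U by exact: openI.
have Ux : U x by [].
have UiU : U `<=` sdom i by move=> y [_ /Ui].
have vXU : vfield U X by apply: vfieldS vX => y [].
have key a : cmul i x (w a x) *m spinor_nabla nabla X sigma x i = 0.
  have vwa : vfield U (w a) by apply: vfieldS (vw a) => y [].
  have wsig y : U y -> cmul i y (w a y) *m sigma y i = 0.
    move=> [Vy Uy]; apply: (lsig y Vy).2; first exact: Ui.
    exact: (frame_of_mem a (fw y Uy)).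
  have Wn : W x (nabla X (w a) x).
    apply: (parW oU vXU vwa _ Ux) => y [_ Uy].
    exact: (frame_of_mem a (fw y Uy)).
  (* Here [Wn] is the use of parallelism of [W]. Expanding this product by [cmul_nabla] and
     substituting the derivative of the identity [wsig] leaves minus the product of [w a x] with the
     spinor derivative. *)
  have := (lsig x Vx).2 i _ ix Wn.
  rewrite (cmul_nabla gP gammaP nablaP oU UiU Ux vXU vwa) mulmxDl mulmxBl.
  rewrite -[spin_conn _ _ _ _ *m _ *m _]mulmxA wsig // mulmx0 sub0r.
  have := mder_local X oU Ux wsig.
  rewrite mder_cst (mderM _ oU) //; last 2 first.
  - exact: (cmul_smooth gP).
  - by apply: msig => y [Vy /Ui].
  move/eqP; rewrite addr_eq0 => /eqP ->; rewrite -opprD => /eqP.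
  by rewrite oppr_eq0 => /eqP; rewrite spinor_nablaE // mulmxDr mulmxA.
rewrite (fw x Ux0).1 => -[c ->]; rewrite (cmul_sum gP) //; last first.
  by move=> a; exact: (vw a).1.
by rewrite mulmx_suml big1 // => a _; rewrite -scalemxAl key scaler0.
Qed.

End PureSpinorLine.

Theorem theorem8 (R : realType) (n : nat) (M : manifold R (n + n))
    (g : M -> tvec M -> tvec M -> R)
    (gamma : 'I_(n + n) -> 'M[R[i]]_(2 ^ n))
    (P : spin_structure g gamma)
    (nabla : (M -> tvec M) -> (M -> tvec M) -> M -> tvec M)
    (k k1 : nat) (W W1 : M -> set (tvec M)) :
  simply_connected R M ->
  neutral_metric g ->
  spinor_module gamma ->
  levi_civita g nabla ->
  tangent_distribution k W -> tangent_distribution k1 W1 ->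
  parallel_distribution nabla W -> parallel_distribution nabla W1 ->
  isotropic g W -> isotropic g W1 ->
  complementary W W1 ->
  exists l : M -> set (svec P),
    complex_subbundle 1 l /\ parallel_subbundle nabla l.
Proof.
move=> _ gP gammaP nablaP distW distW1 parW _ isoW isoW1 complW.
have ranks := complementary_isotropic_ranks P gP distW distW1 isoW isoW1 complW.
(* The definition of the line does not mention the ranks, so it can be given before a point is
   available to identify [k] and [k1] with [n]. *)
exists (spinor_line (P := P) W); split.
  move=> x; have [kn k1n] := ranks x; subst k k1.
  exact: (spinor_line_subbundle P gP gammaP distW distW1 isoW isoW1 complW x).
move=> V X sigma oV vX sp lsig x Vx; have [kn k1n] := ranks x; subst k k1.
exact: (spinor_line_parallel gP gammaP distW distW1 isoW isoW1 complW nablaP parW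
  oV vX sp lsig Vx).
Qed.
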